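(* Forward $\mathsf{QkMSO}$ is expressively equivalent to $\mathsf{RatMTL}$ (over a finite alphabet $\Sigma$): for every $k\in\mathbb{N}$ and every time-constraint formula $\psi(t_0)$ of forward $\mathsf{QkMSO}$ there is a $\mathsf{RatMTL}$ formula $\varphi$ with $L(\varphi)=L(\psi)$, and for every $\mathsf{RatMTL}$ formula $\varphi$ there are $k\in\mathbb{N}$ and a time-constraint formula $\psi(t_0)$ of forward $\mathsf{QkMSO}$ with $L(\psi)=L(\varphi)$.
   Context: Timed words: with $\Gamma=2^\Sigma\setminus\{\emptyset\}$, a finite timed word is $\rho=(\sigma,\tau)$, $\sigma=\sigma_1\cdots\sigma_n$, $\sigma_i\in\Gamma$, $\tau_i\in\mathbb{R}_{\ge0}$, $\tau_1=0$, $\tau_i\le\tau_{i+1}$; $dom(\rho)=\{1,\dots,n\}$. An interval is an open, closed or half-open interval of $\mathbb{R}_{\ge0}$ with endpoints in $\mathbb{N}\cup\{\infty\}$. Forward $\mathsf{QkMSO}$ (parameter $k$): first-order variables $t_0,t_1,\dots$ range over positions, monadic second-order variables $T_1,T_2,\dots$ over sets of positions. For an anchor variable $t_0$, formulas of $MSO^{t_0}$: $\phi::=t_p=t_q\mid t_p<t_q\mid Q_a(t_p)\ (a\in\Sigma)\mid T_j(t_p)\mid\phi\wedge\phi\mid\neg\phi\mid\exists t'.(t'>t_0\wedge\phi)\mid\exists T_i\,\phi\mid\psi(t_p)$, with the usual semantics ($Q_a(t)$ holds iff $a\in\sigma$ at the position of $t$; first-order quantification is over positions after that of $t_0$), where $\psi(t_p)$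 is a time-constraint formula with single free variable $t_p$. A time-constraint formula is $\psi(t_0)=\mathcal{Q}_1t_1\cdots\mathcal{Q}_jt_j\,\phi(\downarrow t_0,t_1,\dots,t_j)$ with $j<k$, $\phi\in MSO^{t_0}$ having free first-order variables among $t_0,\dots,t_j$ and no free second-order variables, and each metric quantifier $\mathcal{Q}_it_i$ of form $\overline{\exists}t_i\in t_0+I_i$ or $\overline{\forall}t_i\in t_0+I_i$ ($I_i$ an interval); $(\rho,a_0)\models\psi(t_0)$ iff there exist / for all positions $a_i\ge a_0$ with $\tau_{a_i}\in\tau_{a_0}+I_i$ (nested in order $i=1,\dots,j$) one has $\rho,(a_0,\dots,a_j)\models\phi$. $L(\psi)=\{\rho:(\rho,1)\models\psi(t_0)\}$. $\mathsf{RatMTL}$: formulas $\varphi::=a\mid\mathrm{true}\mid\varphi\wedge\varphi\mid\neg\varphi\mid\varphi\,\mathsf{U}_I\,\varphi\mid\mathsf{Rat}_I\,\mathsf{re}(\mathsf{S})\mid\mathsf{FRat}_{I,\mathsf{re}(\mathsf{S})}\varphi$, with $\mathsf{S}$ a finite set of formulas and $\mathsf{re}(\mathsf{S})$ a regular expression over alphabet $\mathsf{S}$. $\rho,i\models\varphi_1\mathsf{U}_I\varphi_2$ iff $\exists j>i$, $\rho,j\models\varphi_2$, $\tau_j-\tau_i\in I$, $\rho,k\models\varphi_1$ for $i<k<j$. For $u=u_1\cdots u_m$ over $2^{\mathsf{S}}$, $[u]^{\mathsf{single}}=\{w_1\cdots w_m:w_l\in u_l\}$. $\mathsf{Seg}(\mathsf{S},i,j)$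 labels positions $k=i+1,\dots,j-1$ by $\{\psi\in\mathsf{S}:\rho,k\models\psi\}$; $\mathsf{TSeg}(\mathsf{S},I,i)$ does the same for all positions $k$ with $\tau_k-\tau_i\in I$ in increasing order. $\rho,i\models\mathsf{FRat}_{I,\mathsf{re}}\varphi$ iff $\exists j>i$, $\rho,j\models\varphi$, $\tau_j-\tau_i\in I$, $[\mathsf{Seg}(\mathsf{S},i,j)]^{\mathsf{single}}\cap L(\mathsf{re})\ne\emptyset$; $\rho,i\models\mathsf{Rat}_I\mathsf{re}$ iff $[\mathsf{TSeg}(\mathsf{S},I,i)]^{\mathsf{single}}\cap L(\mathsf{re})\neq\emptyset$. $L(\varphi)=\{\rho:\rho,1\models\varphi\}$. *)

(* Defs.v *)
From HB Require Import structures.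
From mathcomp Require Import all_boot all_order all_algebra.
From mathcomp Require Import reals.
Set Implicit Arguments.
Unset Strict Implicit.
Unset Printing Implicit Defensive.
Import Order.TTheory GRing.Theory Num.Theory.
Local Open Scope ring_scope.

(* Intervals of nonnegative reals with endpoints in N u {oo}; [hi = None] is
   the endpoint oo, in which case [hi_closed] plays no role. *)
Record tinterval := TInterval {
  lo_closed : bool;
  lo : nat;
  hi : option nat;
  hi_closed : bool
}.

Definition in_tinterval (R : realType) (I : tinterval) (x : R) : bool :=
  (if lo_closed I then (lo I)%:R <= x else (lo I)%:R < x) &&
  (if hi I is Some u then
     if hi_closed I then x <= u%:R else x < u%:R
   else true).

(* The positions 1, ..., n of a timed word are the ordinals 0, ..., n - 1.
   As tau_1 = 0 is required, words are nonempty: n = tw_last.+1. *)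
Record timed_word (R : realType) (Sigma : finType) := TimedWord {
  tw_last : nat;
  sigma : 'I_tw_last.+1 -> {set Sigma};
  tau : 'I_tw_last.+1 -> R;
  sigma_neq0 : forall i, sigma i != set0;
  tau_ge0 : forall i, 0 <= tau i;
  tau_first : tau ord0 = 0;
  tau_succ : forall i j : 'I_tw_last.+1, j = i.+1 :> nat -> tau i <= tau j
}.

Definition position (R : realType) (Sigma : finType)
  (rho : timed_word R Sigma) := 'I_(tw_last rho).+1.

Inductive mquant := MQexists | MQforall.

(* First-order variables t_p and second-order variables T_i are named by their
   indices; t_0 is always the anchor of the enclosing time-constraint formula.
   - [MEx p phi] is  exists t_p. (t_p > t_0 /\ phi).
   - [MTc psi p] is  psi(t_p): the variables of [psi] are local to it, and its
     own anchor t_0 is instantiated by t_p.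
   - [Tc [:: (Q_1, I_1); ..; (Q_j, I_j)] phi] is
     Q_1 t_1 in t_0 + I_1 .. Q_j t_j in t_0 + I_j. phi. *)
Inductive mso (Sigma : finType) : Type :=
| MEq of nat & nat
| MLt of nat & nat
| MLetter of Sigma & nat
| MIn of nat & nat
| MAnd of mso Sigma & mso Sigma
| MNot of mso Sigma
| MEx of nat & mso Sigma
| MExSet of nat & mso Sigma
| MTc of tcform Sigma & nat
with tcform (Sigma : finType) : Type :=
| Tc of seq (mquant * tinterval) & mso Sigma.

Fixpoint fo_free (Sigma : finType) (phi : mso Sigma) : seq nat :=
  match phi with
  | MEq p q | MLt p q => [:: p; q]
  | MLetter _ p | MIn _ p => [:: p]
  | MAnd f g => fo_free f ++ fo_free g
  | MNot f | MExSet _ f => fo_free f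
  | MEx p f => 0%N :: [seq q <- fo_free f | q != p]
  | MTc _ p => [:: p]
  end.

Fixpoint so_free (Sigma : finType) (phi : mso Sigma) : seq nat :=
  match phi with
  | MEq _ _ | MLt _ _ | MLetter _ _ | MTc _ _ => [::]
  | MIn i _ => [:: i]
  | MAnd f g => so_free f ++ so_free g
  | MNot f | MEx _ f => so_free f
  | MExSet i f => [seq q <- so_free f | q != i]
  end.

(* [qk_tc k psi]: [psi] is a time-constraint formula of forward QkMSO with
   parameter [k].  Quantifiers may not rebind the anchor t_0. *)
Fixpoint qk_mso (Sigma : finType) (k : nat) (phi : mso Sigma) : bool :=
  match phi with
  | MEq _ _ | MLt _ _ | MLetter _ _ | MIn _ _ => true
  | MAnd f g => qk_mso k f && qk_mso k g
  | MNot f | MExSet _ f => qk_mso k f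
  | MEx p f => (p != 0%N) && qk_mso k f
  | MTc psi _ => qk_tc k psi
  end
with qk_tc (Sigma : finType) (k : nat) (psi : tcform Sigma) : bool :=
  match psi with
  | Tc qs phi =>
      [&& (size qs < k)%N,
          all (fun p => (p <= size qs)%N) (fo_free phi),
          nilp (so_free phi)
        & qk_mso k phi]
  end.

Definition upd (A : Type) (e : nat -> A) (p : nat) (a : A) : nat -> A :=
  fun q => if q == p then a else e q.

(* Evaluates the metric prefix [qs], whose first quantifier binds t_i, around
   the body [K]. *)
Fixpoint metric_sat (R : realType) (Sigma : finType) (rho : timed_word R Sigma)
    (K : (nat -> position rho) -> Prop) (qs : seq (mquant * tinterval))
    (i : nat) (e : nat -> position rho) : Prop :=
  match qs with
  | [::] => K e
  | (MQexists, J) :: qs' =>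
      exists a : position rho,
        [/\ (e 0%N <= a)%N, in_tinterval J (tau a - tau (e 0%N))
          & metric_sat K qs' i.+1 (upd e i a)]
  | (MQforall, J) :: qs' =>
      forall a : position rho,
        (e 0%N <= a)%N -> in_tinterval J (tau a - tau (e 0%N)) ->
        metric_sat K qs' i.+1 (upd e i a)
  end.

(* In [tc_sat] the initial values of the variables other than t_0 are
   irrelevant, as formulas satisfying [qk_tc] have no other free variable. *)
Fixpoint mso_sat (R : realType) (Sigma : finType) (rho : timed_word R Sigma)
    (e : nat -> position rho) (E : nat -> {set position rho})
    (phi : mso Sigma) : Prop :=
  match phi with
  | MEq p q => e p = e q
  | MLt p q => (e p < e q)%N
  | MLetter a p => a \in sigma (e p)
  | MIn i p => e p \in E i
  | MAnd f g => mso_sat e E f /\ mso_sat e E g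
  | MNot f => ~ mso_sat e E f
  | MEx p f =>
      exists a : position rho, (e 0%N < a)%N /\ mso_sat (upd e p a) E f
  | MExSet i f =>
      exists A : {set position rho}, mso_sat e (upd E i A) f
  | MTc psi p => tc_sat (e p) psi
  end
with tc_sat (R : realType) (Sigma : finType) (rho : timed_word R Sigma)
    (a0 : position rho) (psi : tcform Sigma) : Prop :=
  match psi with
  | Tc qs phi =>
      metric_sat (fun e => mso_sat e (fun _ => set0) phi) qs 1 (fun _ => a0)
  end.

Definition tc_lang (R : realType) (Sigma : finType) (psi : tcform Sigma)
    (rho : timed_word R Sigma) : Prop :=
  tc_sat (ord0 : position rho) psi.

Inductive regex (A : Type) : Type :=
| REmpty
| REps
| RSym of A
| RUnion of regex A & regex A
| RConcat of regex A & regex A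
| RStar of regex A.

Inductive re_lang (A : Type) : regex A -> seq A -> Prop :=
| re_eps : re_lang (REps A) [::]
| re_sym a : re_lang (RSym a) [:: a]
| re_unionl r s w : re_lang r w -> re_lang (RUnion r s) w
| re_unionr r s w : re_lang s w -> re_lang (RUnion r s) w
| re_concat r s v w :
    re_lang r v -> re_lang s w -> re_lang (RConcat r s) (v ++ w)
| re_star0 r : re_lang (RStar r) [::]
| re_starS r v w :
    re_lang r v -> re_lang (RStar r) w -> re_lang (RStar r) (v ++ w).

(* [Until phi I psi] is phi U_I psi.  The finite set S of formulas is given by
   an enumeration S : 'I_n -> ratmtl, the letter of a regular expression over S
   being the index of the formula. *)
Inductive ratmtl (Sigma : finType) : Type :=
| Atom of Sigma
| TrueF
| And of ratmtl Sigma & ratmtl Sigma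
| Not of ratmtl Sigma
| Until of ratmtl Sigma & tinterval & ratmtl Sigma
| RatM (I : tinterval) (n : nat) (S : 'I_n -> ratmtl Sigma) (re : regex 'I_n)
| FRatM (I : tinterval) (n : nat) (S : 'I_n -> ratmtl Sigma) (re : regex 'I_n)
    (phi : ratmtl Sigma).

(* Words over 2^A are sequences of predicates on A; [single u] is the set of
   words w_1 .. w_m with w_l in u_l. *)
Fixpoint single (A : Type) (u : seq (A -> Prop)) (w : seq A) : Prop :=
  match u, w with
  | [::], [::] => True
  | U :: u', x :: w' => U x /\ single u' w'
  | _, _ => False
  end.

(* [lab k] is the set of elements of S that hold at position k; [enum] lists
   the positions in increasing order.  When 0 is in I, [TSeg lab I i] contains i
   and all positions, earlier ones included, with the same time stamp as i. *)
Definition Seg (R : realType) (Sigma : finType) (rho : timed_word R Sigma)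
    (A : Type) (lab : position rho -> A -> Prop) (i j : position rho) :
    seq (A -> Prop) :=
  [seq lab k | k : position rho <- enum (position rho) & (i < k < j)%N].

Definition TSeg (R : realType) (Sigma : finType) (rho : timed_word R Sigma)
    (A : Type) (lab : position rho -> A -> Prop) (I : tinterval)
    (i : position rho) : seq (A -> Prop) :=
  [seq lab k | k : position rho <- enum (position rho)
     & in_tinterval I (tau k - tau i)].

Fixpoint ratmtl_sat (R : realType) (Sigma : finType) (rho : timed_word R Sigma)
    (i : position rho) (phi : ratmtl Sigma) : Prop :=
  match phi with
  | Atom a => a \in sigma i
  | TrueF => True
  | And f g => ratmtl_sat i f /\ ratmtl_sat i g
  | Not f => ~ ratmtl_sat i f
  | Until f J g =>
      exists j : position rho,
        [/\ (i < j)%N, ratmtl_sat j g, in_tinterval J (tau j - tau i)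
          & forall k : position rho, (i < k < j)%N -> ratmtl_sat k f]
  | RatM J n fs re =>
      exists w : seq 'I_n,
        single (TSeg (fun k x => ratmtl_sat k (fs x)) J i) w /\ re_lang re w
  | FRatM J n fs re f =>
      exists j : position rho,
        [/\ (i < j)%N, ratmtl_sat j f, in_tinterval J (tau j - tau i)
          & exists w : seq 'I_n,
              single (Seg (fun k x => ratmtl_sat k (fs x)) i j) w /\
              re_lang re w]
  end.

Definition ratmtl_lang (R : realType) (Sigma : finType) (phi : ratmtl Sigma)
    (rho : timed_word R Sigma) : Prop :=
  ratmtl_sat (ord0 : position rho) phi.

(* Main.v *)
(** Both directions rest on splitting a word into finitely many factors.

    From QkMSO to RatMTL: relative to the anchor, time distances fall into
    finitely many regions (the points 0, 1, ..., C, the gaps between them, and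
    the distances above C), and the metric quantifiers only see the regions.  So
    the suffix of the word at the anchor, annotated with its regions, is
    evaluated by a map f into a finite set with f (u ++ v) = op (f u) (f v)
    (Buechi's theorem; f takes one-letter words to RatMTL-definable values, by
    induction on the nesting of time constraints).  The suffix is the
    concatenation of its segments of constant region, and by Kleene's theorem
    the value of f on each of them is expressed by Rat or FRat over that region.

    From RatMTL to QkMSO: Rat can look back at earlier positions carrying the
    same time stamp, which forward QkMSO cannot do.  So every time constraint is
    anchored at the first position of a block of equal time stamps, which has the
    same clock.  A formula evaluated inside the block is recovered by splitting
    its regular expression at the end of the block into finitely many pairs: the
    first part is matched in MSO, the second is a time constraint at the start of
    the block.  Matching of a regular expression on a segment is an MSO property
    by recursion on the expression, the star being a reflexive transitive
    closure. *)

Require Import Defs.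
From HB Require Import structures.
From mathcomp Require Import all_boot all_order all_algebra.
From mathcomp Require Import boolp reals zify.
Set Implicit Arguments.
Unset Strict Implicit.
Unset Printing Implicit Defensive.
Import Order.TTheory GRing.Theory Num.Theory.

(** * Regular expressions *)

Section RegularExpressions.
Context {A : Type}.
Implicit Types (r s : regex A) (u v w : seq A).

Lemma re_emptyP w : re_lang (REmpty A) w <-> False.
Proof. by split=> // H; inversion H. Qed.

Lemma re_epsP w : re_lang (REps A) w <-> w = [::].
Proof. by split=> [H|->]; [inversion H | constructor]. Qed.

Lemma re_symP a w : re_lang (RSym a) w <-> w = [:: a].
Proof. by split=> [H|->]; [inversion H | constructor]. Qed.

Lemma re_unionP r s w :
  re_lang (RUnion r s) w <-> re_lang r w \/ re_lang s w.
Proof.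
split=> [H|[H|H]]; [|exact: re_unionl|exact: re_unionr].
by inversion H; [left | right].
Qed.

Lemma re_concatP r s w : re_lang (RConcat r s) w <->
  exists u v, [/\ w = u ++ v, re_lang r u & re_lang s v].
Proof.
split=> [H|[u [v [-> Hu Hv]]]]; last exact: re_concat.
by inversion H; subst; exists v, w0.
Qed.

Lemma re_star_rect r (P : seq A -> Prop) : P [::] ->
  (forall u v, re_lang r u -> re_lang (RStar r) v -> P v -> P (u ++ v)) ->
  forall w, re_lang (RStar r) w -> P w.
Proof.
move=> P0 PS w; move Es: (RStar r) => s H.
elim: H Es => //= t u v Hu _ Hv IH Es; case: Es => Et; subst t.
by apply: PS => //; apply: IH.
Qed.

Lemma re_star_cat r v w :
  re_lang (RStar r) v -> re_lang (RStar r) w -> re_lang (RStar r) (v ++ w).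
Proof.
move=> Hv Hw; move: v Hv; apply: re_star_rect => //= x y Hx _ IH.
by rewrite -catA; apply: re_starS.
Qed.

Lemma re_star1 r w : re_lang r w -> re_lang (RStar r) w.
Proof. by move=> H; rewrite -[w]cats0; apply: re_starS => //; apply: re_star0. Qed.

(** Each pair describes one place where the cut of an accepted word can fall. For the star the cut
    falls within one iteration, with complete iterations on both sides; the pair of [REps] serves
    the empty word. *)
Fixpoint re_split r : seq (regex A * regex A) :=
  match r with
  | REmpty => [::]
  | REps => [:: (REps A, REps A)]
  | RSym a => [:: (REps A, RSym a); (RSym a, REps A)]
  | RUnion r s => re_split r ++ re_split s
  | RConcat r s =>
      [seq (p.1, RConcat p.2 s) | p <- re_split r] ++
      [seq (RConcat r p.1, p.2) | p <- re_split s]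
  | RStar r =>
      (REps A, REps A) ::
      [seq (RConcat (RStar r) p.1, RConcat p.2 (RStar r)) | p <- re_split r]
  end.

(** Levi's lemma: of two cuts of the same word one does not come after the other, and z is the piece
    between them. *)
Lemma cat_eq_cat u v x y : u ++ v = x ++ y ->
  (exists z, x = u ++ z /\ v = z ++ y) \/ (exists z, u = x ++ z /\ y = z ++ v).
Proof.
elim: u x => [|a u IH] [|b x] /= => [->|->|<-|[-> /IH]].
- by left; exists [::].
- by left; exists (b :: x).
- by right; exists (a :: u).
- by case=> -[z [-> ->]]; [left|right]; exists z.
Qed.

(** Induction on [r], locating the cut between u and v relative to the factorisation that [r]
    provides; for the star a further induction runs over the iterations. *)
Lemma re_splitP r u v : re_lang r (u ++ v) <->
  exists p, [/\ List.In p (re_split r), re_lang p.1 u & re_lang p.2 v].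
Proof.
elim: r u v => [||a|r IHr s IHs|r IHr s IHs|r IHr] u v /=.
- by rewrite re_emptyP; split=> // -[p []].
- rewrite re_epsP; split=> [|[p [[|[]] <- /re_epsP -> /re_epsP ->]]] //.
  by case: u => // /= ->; exists (REps A, REps A); split; [left| |]; constructor.
- rewrite re_symP; split.
    case: u => [|b [|c u]] //= E; [exists (REps A, RSym a)|exists (RSym a, REps A)].
      by rewrite E; split; [left| |]; constructor.
    by case: E => -> ->; split; [right; left| |]; constructor.
  by case=> p [[<-|[<-|[]]]] => [/re_epsP->/re_symP->|/re_symP->/re_epsP->].
- rewrite re_unionP IHr IHs; split.
    by case=> -[p [Hp Hu Hv]]; exists p; split=> //; apply: List.in_or_app; [left|right].
  by case=> p [/(@List.in_app_or _ _ _ _)[] Hp Hu Hv]; [left|right]; exists p.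
- rewrite re_concatP; split.
    case=> x [y [/cat_eq_cat [[z [-> ->]]|[z [-> ->]]] Hx Hy]].
      have [p [Hp Hu Hz]] := (IHr _ _).1 Hx.
      exists (p.1, RConcat p.2 s); split=> //; last by apply: re_concat.
      apply: List.in_or_app; left.
      exact: (@List.in_map _ _ (fun p : regex A * regex A => (p.1, RConcat p.2 s))).
    have [p [Hp Hz Hv]] := (IHs _ _).1 Hy.
    exists (RConcat r p.1, p.2); split=> //; last by apply: re_concat.
    apply: List.in_or_app; right.
    exact: (@List.in_map _ _ (fun p : regex A * regex A => (RConcat r p.1, p.2))).
  case=> p [/(@List.in_app_or _ _ _ _)[] /List.in_map_iff [q [<- Hq]]] /=.
    move=> Hu /re_concatP [x [y [-> Hx Hy]]].
    by exists (u ++ x), y; rewrite catA; split=> //; apply/IHr; exists q.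
  move=> /re_concatP [x [y [-> Hx Hy]]] Hv.
  by exists x, (y ++ v); rewrite catA; split=> //; apply/IHs; exists q.
- split.
    move Ew: (u ++ v) => w Hw; move: w Hw u v Ew.
    apply: re_star_rect => [[|//] [|//] _|x y Hx Hy IH u v].
      by exists (REps A, REps A); split; [left| |]; constructor.
    move/cat_eq_cat => [[z [E ->]]|[z [-> /esym/IH [p [Hp Hz Hv]]]]].
      rewrite E in Hx; have [p [Hp Hu Hz]] := (IHr _ _).1 Hx.
      exists (RConcat (RStar r) p.1, RConcat p.2 (RStar r)); split.
      - right; exact: (@List.in_map _ _
          (fun p : regex A * regex A => (RConcat (RStar r) p.1, RConcat p.2 (RStar r)))).
      - by rewrite -[u]cat0s; apply: re_concat => //; apply: re_star0.
      - exact: re_concat.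
    case: Hp Hz Hv => [<- /re_epsP -> /re_epsP ->|/List.in_map_iff [q [<- Hq]]] /=.
      (* Here z and v are empty: the cut is at the end of the word, and the iteration x is itself
         cut into x and the empty word. *)
      rewrite cats0; have := Hx; rewrite -{1}[x]cats0 => /IHr [p' [Hp Hu Hz]].
      exists (RConcat (RStar r) p'.1, RConcat p'.2 (RStar r)); split.
      - right; exact: (@List.in_map _ _
          (fun p : regex A * regex A => (RConcat (RStar r) p.1, RConcat p.2 (RStar r)))).
      - by rewrite -[x]cat0s; apply: re_concat => //; apply: re_star0.
      - by rewrite -[[::]]cat0s; apply: re_concat => //; apply: re_star0.
    move=> /re_concatP [z1 [z2 [-> Hz1 Hz2]]] Hv.
    exists (RConcat (RStar r) q.1, RConcat q.2 (RStar r)); split=> //.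
      right; exact: (@List.in_map _ _
        (fun p : regex A * regex A => (RConcat (RStar r) p.1, RConcat p.2 (RStar r)))).
    by rewrite catA; apply: re_concat => //; apply: re_starS.
  case=> p [[<- /re_epsP-> /re_epsP->|]]; first exact: re_star0.
  move/List.in_map_iff => [q [<- Hq]] /re_concatP [x [y [-> Hx Hy]]].
  move/re_concatP => [z [t [-> Hz Ht]]]; rewrite -catA; apply: re_star_cat => //.
  by rewrite catA; apply: re_starS => //; apply/IHr; exists q.
Qed.

Definition regular (L : seq A -> Prop) :=
  exists r, forall w, re_lang r w <-> L w.

Lemma eq_regular (L L' : seq A -> Prop) :
  (forall w, L w <-> L' w) -> regular L -> regular L'.
Proof. by move=> E [r Hr]; exists r => w; rewrite Hr. Qed.

Lemma regular_const (c : Prop) : regular (fun w => c /\ w = [::]).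
Proof.
have [Hc|Hc] := pselect c.
  by exists (REps A) => w; rewrite re_epsP; split=> [|[]].
by exists (REmpty A) => w; rewrite re_emptyP; split=> [|[]].
Qed.

Lemma regularU (L L' : seq A -> Prop) : regular L -> regular L' ->
  regular (fun w => L w \/ L' w).
Proof. by move=> [r Hr] [s Hs]; exists (RUnion r s) => w; rewrite re_unionP Hr Hs. Qed.

End RegularExpressions.

(** * Kleene's theorem: finite automata accept regular languages *)

Section Kleene.
Context {X Q : finType} (d : Q -> X -> Q).
Implicit Types (Z : seq Q) (p q z : Q) (w : seq X).

Lemma regular_letters (P : X -> Prop) :
  regular (fun w => exists2 x, P x & w = [:: x]).
Proof.
suff H (s : seq X) : regular (fun w => exists2 x, x \in s /\ P x & w = [:: x]).
  apply: eq_regular (H (enum X)) => w; split=> -[x].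
    by case=> _ Px ->; exists x.
  by move=> Px ->; exists x; rewrite ?mem_enum.
elim: s => [|y s [r Hr]].
  by exists (REmpty X) => w; rewrite re_emptyP; split=> // -[x []].
have [Py|Py] := pselect (P y); last first.
  exists r => w; rewrite Hr; split=> -[x [xs Px] ->]; exists x => //; split=> //.
    by rewrite inE xs orbT.
  by move: xs Px; rewrite inE => /orP[/eqP-> //|].
exists (RUnion (RSym y) r) => w; rewrite re_unionP re_symP Hr; split.
  case=> [->|[x [xs Px] ->]]; first by exists y; rewrite ?inE ?eqxx.
  by exists x => //; rewrite inE xs orbT.
case=> x []; rewrite inE => /orP[/eqP-> _ ->|xs Px ->]; first by left.
by right; exists x.
Qed.

(* Only the intermediate states have to lie in Z, not p and q. *)
Fixpoint run_within Z p q w : bool :=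
  match w with
  | [::] => p == q
  | x :: w' =>
      if w' is [::] then d p x == q
      else (d p x \in Z) && run_within Z (d p x) q w'
  end.

Lemma run_within_cat Z p z q u v : z \in Z ->
  run_within Z p z u -> run_within Z z q v -> run_within Z p q (u ++ v).
Proof.
move=> zZ; elim: u p => [|x u IH] p; first by move/eqP->.
case: u IH => [_|y u IH]; last first.
  rewrite [run_within _ _ _ (x :: _)]/= -/(run_within _ _ _ (y :: u)).
  by move=> /andP[H1 H2] H3; have := IH _ H2 H3; rewrite /= H1.
by move=> /= /eqP->; case: v => [|y v] /=; rewrite ?zZ.
Qed.

Lemma run_within_sub Z Z' p q w : {subset Z <= Z'} ->
  run_within Z p q w -> run_within Z' p q w.
Proof.
move=> sZ; elim: w p => [|x [|y w] IH] p //.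
by move=> /andP[/sZ H1 /IH H2]; apply/andP.
Qed.

(** A run is cut at its intermediate visits to z: the pieces before the first and after the last
    visit stay within Z, and the loops from z to z between them form the star. *)
Lemma run_within_cons z Z r p q w :
  (forall v, re_lang r v <-> run_within Z z z v) ->
  run_within (z :: Z) p q w <-> run_within Z p q w \/ exists u v t,
    [/\ w = u ++ v ++ t, run_within Z p z u, re_lang (RStar r) v
      & run_within Z z q t].
Proof.
move=> Hr; have zz : z \in z :: Z by rewrite inE eqxx.
have sub : {subset Z <= z :: Z} by move=> y yZ; rewrite inE yZ orbT.
split; last first.
  case=> [|[u [v [t [-> Hu Hv Ht]]]]]; first exact: run_within_sub.
  apply: (run_within_cat zz); first exact: run_within_sub Hu.
  apply: (run_within_cat zz); last exact: run_within_sub Ht.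
  move: v Hv; apply: re_star_rect => [|x y /Hr Hx _ Hy]; first exact: eqxx.
  exact: (run_within_cat zz) (run_within_sub sub Hx) Hy.
elim: w p => [|x w IH] p; first by left.
case: w IH => [_|y w IH]; first by left.
move=> /andP[]; rewrite inE => /orP[/eqP Ez|Hd] /IH [Hl|[u [v [t [E Hu Hv Ht]]]]].
- right; exists [:: x], [::], (y :: w); rewrite /= Ez eqxx; split=> //.
    exact: re_star0.
  by rewrite -Ez.
- right; exists [:: x], (u ++ v), t; rewrite /= E Ez eqxx catA; split=> //.
  by apply: re_starS => //; apply/Hr; move: Hu; rewrite Ez.
- by left; apply/andP.
- right; exists (x :: u), v, t; rewrite E; split=> //.
  by case: u Hu {E} => [|c u] Hu; [exact: Hu | apply/andP].
Qed.

Lemma regular_run_within Z p q : regular (run_within Z p q).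
Proof.
elim: Z p q => [|z Z IH] p q.
  have := regularU (regular_const (p = q)) (regular_letters (fun x => d p x = q)).
  apply: eq_regular => -[|x [|y w]] /=; split.
  - by case=> [[->]|[]].
  - by move/eqP->; left.
  - by case=> [[]|[y <- [->]]].
  - by move/eqP=> H; right; exists x.
  - by case=> [[]|[]].
  - by [].
have [r Hr] := IH z z; have [r1 Hr1] := IH p z; have [r2 Hr2] := IH z q.
have [r0 Hr0] := IH p q.
exists (RUnion r0 (RConcat r1 (RConcat (RStar r) r2))) => w.
rewrite (run_within_cons _ _ _ Hr) re_unionP Hr0 re_concatP.
split=> -[Hw|]; try by left.
  case=> u [s [-> /Hr1 Hu /re_concatP [v [t [-> Hv /Hr2 Ht]]]]].
  by right; exists u, v, t.
case=> u [v [t [-> /Hr1 Hu Hv /Hr2 Ht]]]; right.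
by exists u, (v ++ t); split=> //; apply: re_concat.
Qed.

Lemma regular_foldl p q : regular (fun w => foldl d p w = q).
Proof.
apply: eq_regular (regular_run_within (enum Q) p q) => w.
suff -> : run_within (enum Q) p q w = (foldl d p w == q) by split=> /eqP.
elim: w p => [|x w IH] p //; rewrite [RHS]/= -IH.
by case: w {IH} => [|y w] //=; rewrite mem_enum.
Qed.

End Kleene.

(** * Positions of a timed word *)

Section Positions.
Context {R : realType} {Sigma : finType}.
Implicit Type rho : timed_word R Sigma.

Lemma tau_le rho (i j : position rho) : i <= j -> (tau i <= tau j)%R.
Proof.
move Ej: (nat_of_ord j) => m; elim: m j Ej => [|m IH] j Ej ij.
  by have -> : i = j by apply: val_inj => /=; lia.
have [ij'|] := leqP i m; last first.
  by move=> mi; have -> : i = j by apply: val_inj => /=; lia.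
have mn : m < (tw_last rho).+1 by have := ltn_ord j; lia.
by apply: le_trans (IH (Ordinal mn) _ ij') _ => //; apply: tau_succ.
Qed.

Lemma tau_lt_pos rho (i j : position rho) : (tau i < tau j)%R -> i < j.
Proof. by rewrite ltNge; apply: contraR; rewrite -leqNgt; apply: tau_le. Qed.

(** Ranks never decrease along [s], so the elements of rank N directly follow those of smaller rank.
    Iterated over N, this cuts a suffix into its segments of constant region. *)
Lemma filter_rank_split (T : Type) (rank : T -> nat) (s : seq T) N :
  pairwise (fun x y => rank x <= rank y) s ->
  [seq x <- s | rank x < N.+1] =
  [seq x <- s | rank x < N] ++ [seq x <- s | rank x == N].
Proof.
elim: s => //= x s IH /andP[Hx /IH ->]; rewrite ltnS.
case: (ltngtP (rank x) N) => [//|//|E] /=.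
suff -> : [seq y <- s | rank y < N] = [::] by [].
move: Hx; rewrite E; elim: s {IH E} => //= y s IH /andP[Ny /IH ->].
by rewrite ltnNge Ny.
Qed.

Lemma pairwise_enum_filter rho (P : pred (position rho)) :
  pairwise (fun i j : position rho => i < j)
           [seq k <- enum (position rho) | P k].
Proof.
apply: subseq_pairwise (filter_subseq _ _) _.
rewrite -(pairwise_map val ltn) val_enum_ord -sorted_pairwise; last exact: ltn_trans.
exact: iota_ltn_sorted.
Qed.

Lemma sub_pairwise (T : Type) (r r' : rel T) (s : seq T) :
  subrel r r' -> pairwise r s -> pairwise r' s.
Proof.
move=> rr'; elim: s => //= x s IH /andP[Hx /IH ->]; rewrite andbT.
by apply: sub_all Hx => y; apply: rr'.
Qed.

(** Each position carries exactly one label, so [single] leaves no choice. *)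
Lemma single_map (T : Type) (U : Type) (lab : T -> U -> Prop) (c : T -> U) s w :
  (forall k x, lab k x <-> c k = x) ->
  single [seq lab k | k <- s] w <-> w = map c s.
Proof.
move=> H; elim: s w => [|k s IH] [|x w] //=.
rewrite H IH; split=> [[-> ->] //|[-> ->]//].
Qed.

End Positions.

(** * Regions of nonnegative reals *)

Section Regions.
Context {R : realType}.
Implicit Types (x : R) (J : tinterval).

(* For x >= 0, the region is 2 n if x = n <= C, 2 n + 1 if n < x < n + 1 <= C,
   and 2 C + 1 if x > C. *)
Fixpoint region C x : nat :=
  if C is C'.+1 then region C' x + (C%:R <= x)%R + (C%:R < x)%R
  else (0 < x)%R.

(** The endpoint n corresponds to the region 2 n, so membership in an interval becomes a comparison
    of region numbers. *)
Definition inregion r J : bool :=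
  (if lo_closed J then (lo J).*2 <= r else (lo J).*2 < r) &&
  (if hi J is Some u then if hi_closed J then r <= u.*2 else r < u.*2
   else true).

Definition max_endpoint J := maxn (lo J) (odflt 0 (hi J)).

(** Even regions are points and odd ones open gaps, the last gap being unbounded. *)
Definition region_itv C r : tinterval :=
  if odd r then
    TInterval false r./2 (if r./2 < C then Some r./2.+1 else None) false
  else TInterval true r./2 (Some r./2) true.

Lemma region_le C x : region C x <= C.*2.+1.
Proof. by elim: C => [|C IH] /=; lia. Qed.

Lemma region_mono C x y : (x <= y)%R -> region C x <= region C y.
Proof.
move=> xy; have H b : ((b <= x)%R <= (b <= y)%R) /\ ((b < x)%R <= (b < y)%R).
  have h1 : (b <= x)%R ==> (b <= y)%R by apply/implyP => /le_trans; apply.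
  have h2 : (b < x)%R ==> (b < y)%R by apply/implyP => /lt_le_trans; apply.
  by split; [move: h1 | move: h2]; do 2 case: (_ b _).
elim: C => [|C IH] /=; first by case: (H 0%R).
by have [h1 h2] := H C.+1%:R%R; rewrite !leq_add.
Qed.

(** [region C x] counts which of the conditions 0 < x, 1 <= x, 1 < x, ..., C <= x, C < x hold. Each
    of them implies the earlier ones, so the count tells exactly which hold. *)
Lemma leq_region C n x : (0 <= x)%R -> n <= C ->
  (n%:R <= x)%R = (n.*2 <= region C x) /\ (n%:R < x)%R = (n.*2 < region C x).
Proof.
move=> x0; elim: C n => [|C IH] n.
  by rewrite leqn0 => /eqP-> /=; rewrite x0; case: (_ < _)%R.
have leC := region_le C x; have [_ H2] := IH C (leqnn C).
have CC : (C%:R < C.+1%:R :> R)%R by rewrite ltr_nat.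
rewrite leq_eqVlt => /orP[/eqP-> /=|nC].
  have [C1|C1] := lerP C.+1%:R%R x.
    have := lt_le_trans CC C1; rewrite H2 => H3.
    by case: (_ < _)%R; lia.
  have -> : (C.+1%:R < x)%R = false by apply/negbTE; rewrite -leNgt ltW.
  by lia.
have [E1 E2] := IH n nC; rewrite E1 E2 /=.
have [C1|C1] := lerP C.+1%:R%R x.
  have nx : (n%:R < x)%R by apply: lt_le_trans C1; rewrite ltr_nat.
  by move: nx; rewrite E2 => nx; lia.
have -> : (C.+1%:R < x)%R = false by apply/negbTE; rewrite -leNgt ltW.
by rewrite !addn0.
Qed.

Lemma in_tinterval_region C J x : (0 <= x)%R -> max_endpoint J <= C ->
  in_tinterval J x = inregion (region C x) J.
Proof.
move=> x0; rewrite /max_endpoint geq_max => /andP[lC hC].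
have [E1 E2] := leq_region x0 lC; rewrite /in_tinterval /inregion E1 E2.
congr (_ && _); case: (hi J) hC => //= u uC.
have [F1 F2] := leq_region x0 uC.
by case: ifP => _; [rewrite leNgt F2 -leqNgt | rewrite ltNge F1 -ltnNge].
Qed.

(** The conjunct 0 <= x is there because [region] sends negative numbers to 0 as well. *)
Lemma in_region_itv C r x : r <= C.*2.+1 ->
  in_tinterval (region_itv C r) x = (0 <= x)%R && (region C x == r).
Proof.
move=> rC; have [x0|x0] /= := lerP 0%R x; last first.
  have H n : (n%:R <= x)%R = false by apply/negbTE; rewrite -ltNge (lt_le_trans x0).
  have H' n : (n%:R < x)%R = false by apply: contraFF (H n) => /ltW.
  by rewrite /in_tinterval /region_itv; case: odd; rewrite /= ?H ?H'.
have := region_le C x; rewrite (@in_tinterval_region C) //.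
  rewrite /inregion /region_itv; case: (boolP (odd r)) => Hr /=; last by lia.
  by case: (ltnP r./2 C) => /= ?; lia.
rewrite /max_endpoint /region_itv; case: (boolP (odd r)) => Hr /=; last by lia.
by case: (ltnP r./2 C) => /= ?; lia.
Qed.

End Regions.

(** * Properties of positions expressible in RatMTL *)

Section Expressible.
Context {R : realType} {Sigma : finType}.
Implicit Type rho : timed_word R Sigma.

(** Word and position are bundled so that a property, and the one formula expressing it, ranges over
    all words at once. *)
Definition point : Type := {rho : timed_word R Sigma & position rho}.
Definition at_pos rho (k : position rho) : point := existT _ rho k.
Definition sat (x : point) (f : ratmtl Sigma) : Prop := ratmtl_sat (projT2 x) f.

Definition expressible (K : point -> Prop) :=
  exists f, forall x, sat x f <-> K x.

Definition definable (M : finType) (h : point -> M) :=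
  forall m, expressible (fun x => h x = m).

Lemma eq_expressible (K K' : point -> Prop) :
  (forall x, K x <-> K' x) -> expressible K -> expressible K'.
Proof. by move=> E [f Hf]; exists f => x; rewrite Hf. Qed.

Lemma expressible_not K : expressible K -> expressible (fun x => ~ K x).
Proof. by move=> [f Hf]; exists (Not f) => x; rewrite /sat /= -/(sat x f) Hf. Qed.

Lemma expressible_and K K' : expressible K -> expressible K' ->
  expressible (fun x => K x /\ K' x).
Proof.
move=> [f Hf] [g Hg]; exists (And f g) => x.
by rewrite /sat /= -/(sat x f) -/(sat x g) Hf Hg.
Qed.

Lemma expressible_or K K' : expressible K -> expressible K' ->
  expressible (fun x => K x \/ K' x).
Proof.
move=> /expressible_not H /expressible_not H'.
apply: eq_expressible (expressible_not (expressible_and H H')) => x.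
by rewrite -not_orE; split=> [/contrapT|H1 H2].
Qed.

Lemma expressible_const (c : Prop) : expressible (fun=> c).
Proof.
have T : expressible (fun=> True) by exists (TrueF Sigma).
have [Hc|Hc] := pselect c; first by apply: eq_expressible T.
by apply: eq_expressible (expressible_not T) => x; split=> // /(_ I).
Qed.

Lemma expressible_ex (I : finType) (K : I -> point -> Prop) :
  (forall i, expressible (K i)) -> expressible (fun x => exists i, K i x).
Proof.
move=> H; suff Hs (s : seq I) : expressible (fun x => exists2 i, i \in s & K i x).
  apply: eq_expressible (Hs (enum I)) => x; split=> -[i].
    by exists i.
  by move=> Ki; exists i; rewrite ?mem_enum.
elim: s => [|i s IH].
  by apply: eq_expressible (expressible_const False) => x; split=> // -[].
apply: eq_expressible (expressible_or (H i) IH) => x; split.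
  case=> [Ki|[j js Kj]]; first by exists i; rewrite ?inE ?eqxx.
  by exists j; rewrite // inE js orbT.
case=> j; rewrite inE => /orP[/eqP->|js] Kj; first by left.
by right; exists j.
Qed.

Lemma definable_bool (b : point -> bool) : expressible b -> definable b.
Proof.
move=> H [|]; first by [].
by apply: eq_expressible (expressible_not H) => x; split=> [/negP/negbTE|->].
Qed.

(** [h1] and [h2] take finitely many values, so a finite disjunction runs over the pairs of values
    that [F] sends to m. *)
Lemma definable_comp2 (M1 M2 M : finType) (F : M1 -> M2 -> M) h1 h2 :
  definable h1 -> definable h2 -> definable (fun x => F (h1 x) (h2 x)).
Proof.
move=> D1 D2 m.
apply: (@eq_expressible (fun x => exists p : M1 * M2,
    [/\ h1 x = p.1 /\ h2 x = p.2 & F p.1 p.2 = m])).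
  move=> x; split=> [[p [[-> ->]]]|H] //.
  by exists (h1 x, h2 x).
apply: expressible_ex => p; apply: eq_expressible
  (expressible_and (expressible_and (D1 p.1) (D2 p.2)) (expressible_const (F p.1 p.2 = m))).
by move=> x; split=> -[].
Qed.

Lemma expressible_definable (M : finType) (h : point -> M) (P : pred M) :
  definable h -> expressible (fun x => P (h x)).
Proof. by move=> D; apply: (definable_comp2 (fun m (_ : M) => P m) D D true). Qed.

Section Labels.
Context (J : tinterval) (n : nat) (K : 'I_n -> point -> Prop) (re : regex 'I_n).
Hypothesis HK : forall i, expressible (K i).

(** The formulas are obtained by choice; an equality of functions can be rewritten inside [TSeg] and
    [Seg]. *)
Lemma label_formulas : exists fs : 'I_n -> ratmtl Sigma, forall rho,
  (fun (k : position rho) i => ratmtl_sat k (fs i)) =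
  (fun k i => K i (at_pos k)).
Proof.
exists (fun i => projT1 (cid (HK i))) => rho.
apply/funext=> k; apply/funext=> i; apply/propext.
exact: (projT2 (cid (HK i)) (at_pos k)).
Qed.

Lemma expressible_rat : expressible (fun x => exists w,
  single (TSeg (fun k i => K i (at_pos k)) J (projT2 x)) w /\ re_lang re w).
Proof.
have [fs Hfs] := label_formulas; exists (RatM J fs re) => -[rho i].
by rewrite /sat /= Hfs.
Qed.

Lemma expressible_frat (K' : point -> Prop) : expressible K' ->
  expressible (fun x => exists j : position (projT1 x),
    [/\ projT2 x < j, K' (at_pos j), in_tinterval J (tau j - tau (projT2 x))%R
      & exists w, single (Seg (fun k i => K i (at_pos k)) (projT2 x) j) w /\
          re_lang re w]).
Proof.
have [fs Hfs] := label_formulas => -[f Hf]; exists (FRatM J fs re f) => -[rho i].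
rewrite /sat /= Hfs.
by split=> -[j [ij Hj HJ Hw]]; exists j; split=> //; apply/(Hf (at_pos j)).
Qed.

End Labels.

Lemma expressible_next J : expressible (fun x => exists j : position (projT1 x),
  projT2 x < j /\ in_tinterval J (tau j - tau (projT2 x))%R).
Proof.
exists (Until (TrueF _) J (TrueF _)) => -[rho i]; rewrite /sat /=.
by split=> -[j]; [case=> ij _ Hj _|case=> ij Hj]; exists j.
Qed.

End Expressible.

(** * Recognizable languages of annotated words *)

Section Recognizable.
Context {R : realType} {Sigma : finType}.
Implicit Type rho : timed_word R Sigma.
Local Notation point := (@point R Sigma).

(* A position, the first- and second-order variables marking it, and the region
   of its time distance to the anchor. *)
Record letter := Letter {
  l_pt : point; l_fo : nat -> bool; l_so : nat -> bool; l_reg : nat }.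

(* The alphabet is infinite, but the value of a one-letter word is required to
   be RatMTL-definable once the marks and the region are fixed. *)
Definition recognizable (L : seq letter -> Prop) :=
  exists (M : finType) (f : seq letter -> M) (op : M -> M -> M) (P : pred M),
    [/\ forall u v, f (u ++ v) = op (f u) (f v),
        forall fo so r, definable (fun x => f [:: Letter x fo so r])
      & forall w, L w <-> P (f w)].

Lemma recognizable_not L : recognizable L -> recognizable (fun w => ~ L w).
Proof.
move=> [M [f [op [P [H1 H2 H3]]]]]; exists M, f, op, (predC P); split=> // w.
by rewrite H3 /=; split=> /negP.
Qed.

Lemma recognizable_and L L' : recognizable L -> recognizable L' ->
  recognizable (fun w => L w /\ L' w).
Proof.
move=> [M [f [op [P [H1 H2 H3]]]]] [M' [f' [op' [P' [H1' H2' H3']]]]].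
exists (M * M')%type, (fun w => (f w, f' w)),
  (fun p q => (op p.1 q.1, op' p.2 q.2)), (fun p => P p.1 && P' p.2).
split=> [u v|fo so r|w] /=; first by rewrite H1 H1'.
  exact: definable_comp2 (H2 fo so r) (H2' fo so r).
by rewrite H3 H3'; split=> [[-> ->]|/andP[]].
Qed.

Definition letter_definable (b : letter -> bool) :=
  forall fo so r, expressible (fun x => b (Letter x fo so r)).

Lemma letter_definable_marks (b : (nat -> bool) -> (nat -> bool) -> nat -> bool) :
  letter_definable (fun l => b (l_fo l) (l_so l) (l_reg l)).
Proof. by move=> fo so r; exact: (expressible_const (b fo so r)). Qed.

Lemma letter_definable_at (K : point -> Prop) p : expressible K ->
  letter_definable (fun l => `[< K (l_pt l) >] && l_fo l p).
Proof.
move=> H fo so r /=.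
apply: eq_expressible (expressible_and H (expressible_const (fo p))) => x.
by split=> [[/asboolP-> ->]|/andP[/asboolP]].
Qed.

Lemma recognizable_has b : letter_definable b -> recognizable (has b).
Proof.
move=> Hb; exists bool, (has b), orb, id; split=> [u v|fo so r|w] //.
  exact: has_cat.
apply: definable_bool; apply: eq_expressible (Hb fo so r) => x /=.
by rewrite orbF.
Qed.

Fixpoint before (T : Type) (b c : pred T) (w : seq T) : bool :=
  if w is x :: w' then b x && has c w' || before b c w' else false.

Lemma before_cat (T : Type) (b c : pred T) u v :
  before b c (u ++ v) = [|| before b c u, before b c v | has b u && has c v].
Proof.
elim: u => [|x u IH] /=; first by rewrite orbF.
rewrite IH has_cat; case: (b x); case: (has c u); case: (has c v) => //=.
all: by case: (has b u); case: (before b c u); case: (before b c v).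
Qed.

(** To evaluate the pattern on a concatenation, the value must also record whether each factor
    contains a letter in b and one in c. *)
Lemma recognizable_before b c : letter_definable b -> letter_definable c ->
  recognizable (before b c).
Proof.
move=> Hb Hc.
exists (bool * bool * bool)%type, (fun w => (has b w, has c w, before b c w)),
  (fun p q => (p.1.1 || q.1.1, p.1.2 || q.1.2, [|| p.2, q.2 | p.1.1 && q.1.2])),
  (fun p => p.2); split=> [u v|fo so r|w] //.
  by rewrite !has_cat before_cat.
have Db := definable_bool (Hb fo so r); have Dc := definable_bool (Hc fo so r).
have := definable_comp2 (fun x y : bool => (x, y, false)) Db Dc.
move=> D m; apply: eq_expressible (D m) => x /=.
by rewrite !orbF andbF.
Qed.

(** The bits encode the set of positions guessed by a quantifier; [ch] writes them into the
    marks. *)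
Definition remark (ch : bool -> letter -> letter) (bs : seq bool) w :=
  [seq ch p.1 p.2 | p <- zip bs w].

(** Powerset construction: the value of a word is the set of values of all its remarkings, and
    concatenation multiplies these sets elementwise. *)
Lemma recognizable_project (ch : bool -> letter -> letter) fo' so' L :
  (forall b x fo so r, ch b (Letter x fo so r) = Letter x (fo' b fo) (so' b so) r) ->
  recognizable L ->
  recognizable (fun w => exists bs, size bs = size w /\ L (remark ch bs w)).
Proof.
move=> Hch [M [f [op [P [H1 H2 H3]]]]].
pose g w := [set m | `[< exists bs, size bs = size w /\ f (remark ch bs w) = m >]].
have gP w m : reflect (exists bs, size bs = size w /\ f (remark ch bs w) = m) (m \in g w).
  by rewrite inE; apply: asboolP.
exists {set M}, g, (fun X Y : {set M} => op @2: (X, Y)),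
  (fun X : {set M} => [exists m in X, P m]).
split=> [u v|fo so r|w].
- apply/setP=> m; apply/gP/imset2P.
    case=> bs [Hs <-]; rewrite size_cat in Hs.
    have Eu : size (take (size u) bs) = size u by rewrite size_take_min; lia.
    exists (f (remark ch (take (size u) bs) u)) (f (remark ch (drop (size u) bs) v)).
    - by apply/gP; exists (take (size u) bs).
    - by apply/gP; exists (drop (size u) bs); rewrite size_drop; split=> //; lia.
    - by rewrite -H1 /remark -map_cat -zip_cat ?cat_take_drop.
  case=> a b /gP [bs [Hs <-]] /gP [bs' [Hs' <-]] ->.
  exists (bs ++ bs'); rewrite !size_cat Hs Hs'; split=> //.
  by rewrite -H1 /remark -map_cat -zip_cat.
- have D b := H2 (fo' b fo) (so' b so) r.
  move=> X; apply: eq_expressible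
    (definable_comp2 (fun a b : M => [set a; b]) (D true) (D false) X) => x.
  suff -> : g [:: Letter x fo so r] = [set f [:: Letter x (fo' true fo) (so' true so) r];
     f [:: Letter x (fo' false fo) (so' false so) r]] by [].
  apply/setP=> m; rewrite !inE; apply/asboolP/orP.
    case=> bs [Hs <-]; case: bs Hs => [|b [|? ?]] //= _; rewrite /remark /= Hch.
    by case: b; rewrite eqxx; [left|right].
  by case=> /eqP->; [exists [:: true]|exists [:: false]]; rewrite /remark /= Hch.
- split.
    case=> bs [Hs /H3 HP]; apply/existsP; exists (f (remark ch bs w)).
    by rewrite HP andbT; apply/gP; exists bs.
  by case/existsP=> m /andP[/gP [bs [Hs <-]] HP]; exists bs; split=> //; apply/H3.
Qed.

Definition mark_fo p b (l : letter) :=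
  Letter (l_pt l) (upd (l_fo l) p b) (l_so l) (l_reg l).
Definition mark_so i b (l : letter) :=
  Letter (l_pt l) (l_fo l) (upd (l_so l) i b) (l_reg l).

Definition marked_once p (w : seq letter) : Prop :=
  has (fun l => l_fo l p) w /\ ~ before (fun l => l_fo l p) (fun l => l_fo l p) w.

(** A first-order quantifier is treated as a set quantifier restricted to singletons. *)
Definition ex_fo p (L : seq letter -> Prop) (w : seq letter) : Prop :=
  exists bs, size bs = size w /\
    (marked_once p (remark (mark_fo p) bs w) /\ L (remark (mark_fo p) bs w)).
Definition ex_so i (L : seq letter -> Prop) (w : seq letter) : Prop :=
  exists bs, size bs = size w /\ L (remark (mark_so i) bs w).

Lemma recognizable_ex_fo p L : recognizable L -> recognizable (ex_fo p L).
Proof.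
move=> HL; apply: (@recognizable_project (mark_fo p) (fun b fo => upd fo p b)
  (fun _ so => so) (fun w => marked_once p w /\ L w)) => //.
have Dp := letter_definable_marks (fun fo _ _ => fo p).
apply: recognizable_and HL; apply: recognizable_and; first exact: recognizable_has.
by apply: recognizable_not; apply: recognizable_before.
Qed.

Lemma recognizable_ex_so i L : recognizable L -> recognizable (ex_so i L).
Proof.
exact: (@recognizable_project (mark_so i) (fun _ fo => fo) (fun b so => upd so i b)).
Qed.

(** * Valuations encoded as words on the suffix at an anchor *)

Section EnvWord.
Context (rho : timed_word R Sigma) (rf : position rho -> nat) (a0 : position rho).
Implicit Types (e : nat -> position rho) (E : nat -> {set position rho}).

Definition suffix_positions := [seq k : position rho <- enum (position rho) | a0 <= k].

(** The region map [rf] is arbitrary here: the MSO connectives do not read it, and only the metric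
    quantifiers constrain it. *)
Definition env_letter e E (k : position rho) : letter :=
  Letter (at_pos k) (fun p => e p == k) (fun i => k \in E i) (rf k).
Definition env_word e E := [seq env_letter e E k | k <- suffix_positions].

Lemma mem_suffix k : (k \in suffix_positions) = (a0 <= k).
Proof. by rewrite mem_filter mem_enum andbT. Qed.

Lemma uniq_suffix : uniq suffix_positions.
Proof. by rewrite filter_uniq ?enum_uniq. Qed.

Lemma has_suffix (F : position rho -> letter) b :
  has b (map F suffix_positions) <-> exists k : position rho, a0 <= k /\ b (F k).
Proof.
rewrite has_map; split=> [/hasP [k]|[k [Hk Hb]]].
  by rewrite mem_suffix; exists k.
by apply/hasP; exists k; rewrite ?mem_suffix.
Qed.

Lemma has_env_word_at e E p (b : letter -> bool) : a0 <= e p ->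
  has (fun l => b l && l_fo l p) (env_word e E) <-> b (env_letter e E (e p)).
Proof.
move=> ep; rewrite has_suffix; split=> [[k [_ /= /andP[Hb /eqP->]]] //|Hb].
by exists (e p); rewrite Hb /= eqxx.
Qed.

Lemma before_suffix (F : position rho -> letter) b c :
  before b c (map F suffix_positions) <->
  exists i j : position rho, [/\ a0 <= i, i < j, b (F i) & c (F j)].
Proof.
have Hp : pairwise (fun i j : position rho => i < j) suffix_positions.
  exact: pairwise_enum_filter.
transitivity (exists i j, [/\ i \in suffix_positions, j \in suffix_positions,
    i < j, b (F i) & c (F j)]); last first.
  split=> -[i [j]]; rewrite ?mem_suffix.
    by case=> *; exists i, j.
  by case=> Hi ij *; exists i, j; rewrite !mem_suffix; split=> //; lia.
elim: suffix_positions Hp => [|k s IH] /=.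
  by move=> _; split=> // -[i [j []]].
move=> /andP[Hk /IH {}IH]; split.
  case/orP=> [/andP[Hb]|/IH [i [j [Hi Hj ij Hb Hc]]]]; last first.
    by exists i, j; rewrite !inE Hi Hj !orbT.
  rewrite has_map => /hasP [j Hj Hc]; exists k, j; rewrite !inE eqxx Hj orbT.
  by split=> //; apply: (allP Hk).
case=> i [j [Hi Hj ij Hb Hc]]; apply/orP.
move: Hi Hj; rewrite !inE => /orP[/eqP Ei|Hi] /orP[/eqP Ej|Hj].
- by move: ij; rewrite Ei Ej ltnn.
- by left; rewrite -Ei Hb has_map; apply/hasP; exists j.
- by have := allP Hk _ Hi; rewrite -Ej; lia.
- by right; apply/IH; exists i, j.
Qed.

(** The positions of the suffix are distinct, so a list of bits is a function of the position. *)
Lemma map_of_bits (bs : seq bool) e E : size bs = size (env_word e E) ->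
  exists c : position rho -> bool, bs = map c suffix_positions.
Proof.
rewrite size_map => Hs; exists (fun k => nth false bs (index k suffix_positions)).
apply: (@eq_from_nth _ false); rewrite ?size_map // => i; rewrite Hs => Hi.
by rewrite (nth_map a0) // index_uniq ?uniq_suffix.
Qed.

Lemma remark_env_word ch c e E : remark ch (map c suffix_positions) (env_word e E) =
  [seq ch (c k) (env_letter e E k) | k <- suffix_positions].
Proof.
by rewrite /remark /env_word; elim: suffix_positions => //= k s ->.
Qed.

Lemma mark_fo_env_word p a e E :
  [seq mark_fo p (a == k) (env_letter e E k) | k <- suffix_positions] =
  env_word (upd e p a) E.
Proof.
apply: eq_map => k; congr Letter; apply/funext=> q /=.
by rewrite /upd; case: eqP.
Qed.

Lemma ex_foP p L e E : ex_fo p L (env_word e E) <->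
  exists a : position rho, a0 <= a /\ L (env_word (upd e p a) E).
Proof.
split=> [[bs [Hs]]|[a [Ha HL]]].
  have [c ->] := map_of_bits Hs; rewrite remark_env_word => -[[H1 H2] HL].
  move: H1; rewrite has_suffix => -[a []] /=; rewrite /upd eqxx => Ha ca.
  exists a; split=> //; rewrite -mark_fo_env_word.
  suff <- : [seq mark_fo p (c k) (env_letter e E k)
    | k <- suffix_positions] = [seq mark_fo p (a == k) (env_letter e E k)
    | k <- suffix_positions] by [].
  apply/eq_in_map => k; rewrite mem_suffix => Hk.
  congr mark_fo; apply/idP/eqP => [ck|<- //].
  (* A second marked position, on either side of a, would contradict [marked_once]. *)
  have [ak|ka|/val_inj //] := ltngtP a k; case: H2; apply/before_suffix.
    by exists a, k; rewrite /= /upd eqxx.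
  by exists k, a; rewrite /= /upd eqxx.
exists (map (fun k => a == k) suffix_positions); rewrite !size_map; split=> //.
rewrite remark_env_word; split; last by rewrite mark_fo_env_word.
split; first by apply/has_suffix; exists a; rewrite /= /upd !eqxx.
case/before_suffix=> i [j] /=; rewrite /upd !eqxx => -[_ ij /eqP ai /eqP aj].
by move: ij; rewrite -ai -aj ltnn.
Qed.

Lemma ex_soP i L e E : ex_so i L (env_word e E) <->
  exists A, L (env_word e (upd E i A)).
Proof.
have H (A : {set position rho}) :
    [seq mark_so i (k \in A) (env_letter e E k) | k <- suffix_positions] =
    env_word e (upd E i A).
  apply: eq_map => k; congr Letter; apply/funext=> q /=.
  by rewrite /upd; case: eqP.
split=> [[bs [Hs]]|[A HL]].
  have [c ->] := map_of_bits Hs; rewrite remark_env_word => HL.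
  by exists [set k | c k]; rewrite -H; under eq_map do rewrite inE.
exists (map (fun k => k \in A) suffix_positions); rewrite !size_map; split=> //.
by rewrite remark_env_word H.
Qed.

End EnvWord.
End Recognizable.

(** * From QkMSO to RatMTL *)

Section Segments.
Context {R : realType} {Sigma : finType} (C : nat) (M : finType).
Context (f : seq (@letter R Sigma) -> M) (op : M -> M -> M).
Hypothesis f_cat : forall u v, f (u ++ v) = op (f u) (f v).
Hypothesis f_letter : forall fo so r, definable (fun x => f [:: Letter x fo so r]).
Implicit Type rho : timed_word R Sigma.

Let value N x := f [:: Letter x xpred0 xpred0 N].
Let has_value N (i : 'I_#|M|) x : Prop := value N x = enum_val i.

(** The automaton has the elements of [M] as states, starts in [f [::]] and multiplies by the value
    of each letter read. Its alphabet enumerates [M], letter i standing for the property of having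
    the i-th value; exactly one such property holds at each position. *)
Lemma segment_regex N m : exists re : regex 'I_#|M|,
  forall rho (ks : seq (position rho)),
    (exists w, single [seq (fun i => has_value N i (at_pos k)) | k <- ks] w /\
       re_lang re w) <->
    f [seq Letter (at_pos k) xpred0 xpred0 N | k <- ks] = m.
Proof.
have [re Hre] := regular_foldl (fun m (i : 'I_#|M|) => op m (enum_val i)) (f [::]) m.
exists re => rho ks.
pose c (k : position rho) := enum_rank (value N (at_pos k)).
have Hs w : single [seq (fun i => has_value N i (at_pos k)) | k <- ks] w <-> w = map c ks.
  apply: single_map => k i; rewrite /has_value /c.
  by split=> [->|<-]; rewrite ?enum_valK ?enum_rankK.
have Hf u : foldl (fun m (i : 'I_#|M|) => op m (enum_val i)) (f u) (map c ks) =
    f (u ++ [seq Letter (at_pos k) xpred0 xpred0 N | k <- ks]).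
  elim: ks u {Hs} => [|k ks IH] u /=; first by rewrite cats0.
  by rewrite -cat_rcons -IH -cats1 f_cat enum_rankK.
have := Hf [::]; rewrite cat0s => <-; rewrite -Hre; split=> [[w [/Hs -> //]]|H].
by exists (map c ks); split=> //; apply/Hs.
Qed.

Lemma expressible_has_value N i : expressible (has_value N i).
Proof. exact: f_letter. Qed.

Definition segment N (x : @point R Sigma) := [seq k : position (projT1 x) <-
  enum (position (projT1 x)) |
    (projT2 x < k) && (region C (tau k - tau (projT2 x))%R == N)].

(** A position at or before the anchor has distance at most 0, hence never lies in the interval of a
    region N > 0. So [Rat] over that interval reads exactly the segment. *)
Lemma definable_segment_gt0 N : 0 < N <= C.*2.+1 ->
  definable (fun x => f [seq Letter (at_pos k) xpred0 xpred0 N | k <- segment N x]).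
Proof.
move=> /andP[N0 NC] m; have [re Hre] := segment_regex N m.
apply: eq_expressible (expressible_rat (region_itv C N) re (@expressible_has_value N)).
move=> [rho i] /=; rewrite -Hre /TSeg /segment /=.
suff -> : [seq k : position rho <- enum (position rho) |
    in_tinterval (region_itv C N) (tau k - tau i)%R] =
  [seq k : position rho <- enum (position rho) |
    (i < k) && (region C (tau k - tau i)%R == N)] by [].
apply: eq_filter => k; rewrite in_region_itv // subr_ge0.
have [ik|ki] /= := ltnP i k; first by rewrite (tau_le (ltnW ik)).
apply/negbTE/negP => /andP[ik /eqP EN].
have E0 : (tau k - tau i = 0)%R by apply/eqP; rewrite subr_eq0 eq_le ik tau_le.
move: N0; rewrite -EN E0; have [] := @leq_region R C 0 0 (lexx _) isT.
by rewrite ltxx => _ <-.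
Qed.

Lemma region0 (x : R) : (0 <= x)%R -> (region C x == 0) = (x == 0%R).
Proof.
move=> x0; have [_] := leq_region x0 (leq0n C).
by rewrite -[_ == 0]negbK -lt0n => <-; rewrite lt_neqAle x0 andbT negbK eq_sym.
Qed.

Lemma region_eq0 rho (i k : position rho) : i <= k ->
  (region C (tau k - tau i)%R == 0) = (tau k == tau i).
Proof. by move=> ik; rewrite region0 ?subr_eq0 // subr_ge0 tau_le. Qed.

Lemma in_point0 (x : R) : in_tinterval (TInterval true 0 (Some 0) true) x = (x == 0%R).
Proof. by rewrite /in_tinterval /= eq_le andbC. Qed.

Lemma empty_segment0 rho (i : position rho) :
  (~ exists k : position rho, i < k /\
       in_tinterval (TInterval true 0 (Some 0) true) (tau k - tau i)%R) ->
  segment 0 (at_pos i) = [::].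
Proof.
move=> Hn; apply/eqP; rewrite -[_ == _]negbK -has_filter; apply/hasPn => k _.
apply/negP => /andP[/= ik /eqP Ek]; case: Hn; exists k; split=> //.
by rewrite in_point0 subr_eq0 -region_eq0 ?Ek // ltnW.
Qed.

(** [FRat] with target j labels only the positions strictly between i and j, so the last position j
    of the block is split off. *)
Lemma segment0_rcons rho (i j : position rho) : i < j -> tau j = tau i ->
  (~ exists k : position rho, j < k /\
       in_tinterval (TInterval true 0 (Some 0) true) (tau k - tau j)%R) ->
  segment 0 (at_pos i) =
  rcons [seq k : position rho <- enum (position rho) | i < k < j] j.
Proof.
move=> ij Ej last; rewrite /segment /=.
(* The segment consists of the positions after i of index below j + 1; [filter_rank_split], with the
   index as rank, then isolates j. *)
transitivity [seq k : position rho <- [seq k : position rho <- enum (position rho)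
    | i < k] | val k < (val j).+1].
  rewrite -filter_predI; apply: eq_filter => k /=; rewrite ltnS andbC.
  have [ik|_] := ltnP i k; last by rewrite !andbF.
  rewrite (region_eq0 (ltnW ik)).
  rewrite !andbT; have [kj|jk] := leqP k j.
    by rewrite eq_le (tau_le (ltnW ik)) -Ej tau_le.
  apply: (contra_notF _ last) => /eqP Ek; exists k; split=> //.
  by rewrite in_point0 Ek Ej subrr.
rewrite filter_rank_split; last first.
  by apply: sub_pairwise (pairwise_enum_filter _) => ? ?; apply: ltnW.
rewrite -cats1 -filter_predI; congr (_ ++ _).
  by apply: eq_filter => k /=; rewrite andbC.
rewrite (@eq_filter _ _ (pred1 j)) // filter_pred1_uniq //.
  exact: filter_uniq (enum_uniq _).
by rewrite mem_filter ij mem_enum.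
Qed.

(* [Rat] on the interval [0,0] would also see the earlier positions with the
   same time stamp, hence [FRat] up to the last position of that time. *)
Lemma definable_segment0 :
  definable (fun x => f [seq Letter (at_pos k) xpred0 xpred0 0 | k <- segment 0 x]).
Proof.
move=> m; pose J := TInterval true 0 (Some 0) true.
pose next (x : @point R Sigma) := exists j : position (projT1 x),
  projT2 x < j /\ in_tinterval J (tau j - tau (projT2 x))%R.
have Hnext : expressible next by exact: expressible_next.
have Hre m1 := cid (segment_regex 0 m1).
(* [p.1] is the value of the positions strictly between, [p.2] that of j, and [~ next] makes j the
   last position of its time stamp. *)
pose K (p : M * M) (x : @point R Sigma) := op p.1 p.2 = m /\
  exists j : position (projT1 x), [/\ projT2 x < j,
    value 0 (at_pos j) = p.2 /\ ~ next (at_pos j),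
    in_tinterval J (tau j - tau (projT2 x))%R
  & exists w, single (Seg (fun k i => has_value 0 i (at_pos k)) (projT2 x) j) w /\
     re_lang (projT1 (Hre p.1)) w].
apply: (@eq_expressible _ _ (fun x => (~ next x /\ f [::] = m) \/ exists p, K p x)).
  move=> [rho i]; rewrite /K /Seg /=; split.
    case=> [[Hn <-]|].
      by rewrite (empty_segment0 Hn).
    case=> -[m1 m2] [] /= <- [j [ij [<- Hj]]]; rewrite in_point0 subr_eq0 => /eqP Ej.
    move/(projT2 (Hre m1)) => <-.
    by rewrite (segment0_rcons ij Ej Hj) map_rcons -cats1 f_cat.
  have [Hn|Hn] := pselect (next (at_pos i)); last first.
    by move=> <-; left; rewrite (empty_segment0 Hn).
  case: Hn => j0 [/= ij0 Hj0] <-; right.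
  have Pj0 : (i < j0) && (tau j0 == tau i) by rewrite ij0 -subr_eq0 -in_point0.
  have [j /andP[ij] Hj jmax] := @arg_maxnP _ j0
    (fun j : position rho => (i < j) && (tau j == tau i)) val Pj0.
  move: Hj => /eqP Ej; have Hlast : ~ next (at_pos j).
    case=> k [/= jk]; rewrite in_point0 subr_eq0 => /eqP Ek.
    have := jmax k; rewrite Ek Ej eqxx (ltn_trans ij jk) /= => /(_ isT).
    by rewrite leqNgt jk.
  exists (f [seq Letter (at_pos k) xpred0 xpred0 0
    | k : position rho <- enum (position rho) & i < k < j], value 0 (at_pos j)).
  rewrite (segment0_rcons ij Ej Hlast) map_rcons -cats1 f_cat; split=> //.
  exists j; split=> //; first by rewrite in_point0 Ej subrr.
  by apply/(projT2 (Hre _)).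
apply: (expressible_or (expressible_and (expressible_not Hnext)
  (expressible_const (f [::] = m)))).
apply: expressible_ex => p.
apply: (expressible_and (expressible_const (op p.1 p.2 = m))).
apply: (expressible_frat J _ (@expressible_has_value 0)
  (K' := fun x => value 0 x = p.2 /\ ~ next x)).
exact: expressible_and (f_letter _ _ _ _) (expressible_not Hnext).
Qed.

Lemma definable_segment N : N <= C.*2.+1 ->
  definable (fun x => f [seq Letter (at_pos k) xpred0 xpred0 N | k <- segment N x]).
Proof.
case: N => [_|N NC]; first exact: definable_segment0.
exact: definable_segment_gt0.
Qed.

Definition anchored_word (x : @point R Sigma) : seq letter :=
  env_word (fun k => region C (tau k - tau (projT2 x))%R) (projT2 x)
    (fun=> projT2 x) (fun=> set0).

(** Time stamps never decrease, so the suffix is the anchor followed by the segments of regions 0,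
    1, ..., 2 C + 1 in this order, and [op] combines their values. All first-order variables mark
    the anchor, so the other letters carry no mark. *)
Lemma definable_anchored_word : definable (fun x => f (anchored_word x)).
Proof.
pose lower N (x : @point R Sigma) := [seq k : position (projT1 x) <-
  [seq k : position (projT1 x) <- enum (position (projT1 x)) | projT2 x < k]
  | region C (tau k - tau (projT2 x))%R < N].
pose value' (x : @point R Sigma) (k : position (projT1 x)) :=
  Letter (at_pos k) xpred0 xpred0 (region C (tau k - tau (projT2 x))%R).
have D N : N <= C.*2.+2 -> definable (fun x => f [seq value' x k | k <- lower N x]).
  elim: N => [_ m|N IH NC m].
    apply: eq_expressible (expressible_const (f [::] = m)) => x.
    by rewrite /lower (eq_filter (a2 := pred0)) ?filter_pred0.
  apply: eq_expressible (definable_comp2 op (IH (ltnW NC)) (definable_segment NC) m) => x.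
  suff -> : f [seq value' x k | k <- lower N.+1 x] =
    op (f [seq value' x k | k <- lower N x])
       (f [seq Letter (at_pos k) xpred0 xpred0 N | k <- segment N x]) by [].
  rewrite -f_cat /lower filter_rank_split; last first.
    apply: sub_pairwise (pairwise_enum_filter _) => k l kl.
    by apply: region_mono; rewrite lerD2r tau_le // ltnW.
  rewrite map_cat; congr (f (_ ++ _)).
  rewrite /segment -filter_predI.
  rewrite (eq_filter (a2 := fun k : position (projT1 x) => (projT2 x < k) &&
    (region C (tau k - tau (projT2 x))%R == N))); last by move=> k /=; rewrite andbC.
  apply/eq_in_map => k; rewrite mem_filter => /andP[/andP[_ /eqP Ek] _].
  by rewrite /value' Ek.
move=> m; apply: eq_expressible (definable_comp2 op (f_letter xpredT xpred0 0)
  (D _ (leqnn _)) m) => x.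
rewrite -f_cat; suff -> : anchored_word x = [:: Letter x xpredT xpred0 0] ++
  [seq value' x k | k <- lower C.*2.+2 x] by [].
case: x => rho i; rewrite /anchored_word /env_word /=.
have -> : suffix_positions i = i :: lower C.*2.+2 (at_pos i).
  (* Two strictly increasing lists with the same members are equal. *)
  pose lt := fun k l : position rho => k < l.
  have lt_trans : transitive lt by move=> k l h; apply: ltn_trans.
  apply: (@irr_sorted_eq _ lt lt_trans) => [k|||k]; first exact: ltnn.
  - by rewrite (sorted_pairwise lt_trans); apply: pairwise_enum_filter.
  - rewrite (sorted_pairwise lt_trans) /lower -filter_predI /= pairwise_enum_filter andbT.
    by apply/allP => k; rewrite mem_filter => /andP[/andP[]].
  - rewrite mem_suffix in_cons !mem_filter ltnS region_le mem_index_enum andbT /=.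
    by rewrite leq_eqVlt -[k == i]val_eqE eq_sym inE andbT.
rewrite /env_letter /= subrr; congr (Letter _ _ _ _ :: _).
- by apply/funext=> p; rewrite eqxx.
- by apply/funext=> p; rewrite inE.
- by apply/eqP; rewrite region0.
apply/eq_in_map => k; rewrite !mem_filter => /and3P[_ ik _].
congr Letter; apply/funext=> p; last by rewrite inE.
by apply/negbTE; rewrite -val_eqE /= neq_ltn ik.
Qed.

End Segments.

(* Translation by mutual induction on MSO and time-constraint formulas *)
Scheme mso_tcform_ind := Induction for mso Sort Prop
with tcform_mso_ind := Induction for tcform Sort Prop.
Combined Scheme mso_tcform_mutind from mso_tcform_ind, tcform_mso_ind.

Section QkMSOToRatMTL.
Context {R : realType} {Sigma : finType}.
Implicit Types (rho : timed_word R Sigma) (phi : mso Sigma) (psi : tcform Sigma).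

(** One language serves all words, anchors and region maps; the hypothesis on e keeps every variable
    on the suffix that [env_word] reads. *)
Definition mso_recognized phi := exists L, recognizable L /\
  forall rho rf (e : nat -> position rho) E, (forall p, e 0 <= e p) ->
    mso_sat e E phi <-> L (env_word rf (e 0) e E).

Definition tc_expressible psi :=
  expressible (fun x : @point R Sigma => tc_sat (projT2 x) psi).

Lemma upd_other (A : Type) (e : nat -> A) p q a : q != p -> upd e p a q = e q.
Proof. by rewrite /upd => /negbTE->. Qed.

Lemma upd_same (A : Type) (e : nat -> A) p a : upd e p a p = a.
Proof. by rewrite /upd eqxx. Qed.

Lemma upd_ge rho (e : nat -> position rho) p (a : position rho) : 0 < p -> e 0 <= a ->
  (forall q, e 0 <= e q) -> forall q, upd e p a 0 <= upd e p a q.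
Proof.
by move=> p0 ea He q; rewrite {1}/upd eq_sym eqn0Ngt p0 /= /upd; case: eqP.
Qed.

(** A metric quantifier over J is a projection demanding that the mark of t_i sits on a letter whose
    region lies inside J; the universal one is its dual. Here [rf] has to be the true region map,
    with C above all endpoints. *)
Lemma metric_recognized (K : forall rho, (nat -> position rho) -> Prop) L C qs i :
  0 < i -> all (fun q => max_endpoint q.2 <= C) qs -> recognizable L ->
  (forall rho rf (e : nat -> position rho), (forall p, e 0 <= e p) ->
     K rho e <-> L (env_word rf (e 0) e (fun=> set0))) ->
  exists L', recognizable L' /\
    forall rho rf (e : nat -> position rho), (forall p, e 0 <= e p) ->
      (forall k : position rho, e 0 <= k ->
         rf k = region C (tau k - tau (e 0))%R) ->
      metric_sat (@K rho) qs i e <-> L' (env_word rf (e 0) e (fun=> set0)).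
Proof.
move=> + + recL HL; elim: qs i => [|[q J] qs IH] i i0 /=.
  by move=> _; exists L; split=> // rho rf e He _; apply: HL.
case/andP=> JC /(IH i.+1 isT) [L' [recL' HL']].
pose H := has (fun l : @letter R Sigma => inregion (l_reg l) J && l_fo l i).
have recH : recognizable H.
  exact: (recognizable_has (letter_definable_marks
    (fun fo _ r => inregion r J && fo i))).
have E0 rho (e : nat -> position rho) a : upd e i a 0 = e 0.
  by rewrite upd_other // eq_sym -lt0n.
have HH rho rf (e : nat -> position rho) (a : position rho) :
    (forall k : position rho, e 0 <= k ->
         rf k = region C (tau k - tau (e 0))%R) -> e 0 <= a ->
    H (env_word rf (e 0) (upd e i a) (fun=> set0)) <->
    in_tinterval J (tau a - tau (e 0))%R.
  move=> Hrf ea; have ea' : e 0 <= upd e i a i by rewrite upd_same.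
  rewrite (has_env_word_at _ _ (fun l => inregion (l_reg l) J) ea') /= upd_same.
  by rewrite Hrf // -in_tinterval_region // subr_ge0 tau_le.
have IH' rho rf (e : nat -> position rho) (a : position rho) :
    (forall p, e 0 <= e p) -> (forall k : position rho, e 0 <= k ->
         rf k = region C (tau k - tau (e 0))%R) -> e 0 <= a ->
    metric_sat (@K rho) qs i.+1 (upd e i a) <->
    L' (env_word rf (e 0) (upd e i a) (fun=> set0)).
  move=> He Hrf ea; rewrite -(E0 _ e a); apply: HL'; first exact: upd_ge.
  by rewrite E0.
case: q.
  exists (ex_fo i (fun w => L' w /\ H w)); split.
    exact/recognizable_ex_fo/recognizable_and.
  move=> rho rf e He Hrf; rewrite ex_foP.
  split=> [[a [ea Ha Hm]]|[a [ea [Hm Ha]]]]; exists a; split=> //.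
  - by split; [apply/IH' | apply/HH].
  - exact/(HH _ _ _ _ Hrf ea).
  - exact/(IH' _ _ _ _ He Hrf ea).
exists (fun w => ~ ex_fo i (fun w => ~ L' w /\ H w) w); split.
  by apply/recognizable_not/recognizable_ex_fo/recognizable_and => //;
    apply/recognizable_not.
move=> rho rf e He Hrf; rewrite ex_foP; split=> [Hm [a [ea [Hn Ha]]]|Hn a ea Ha].
  by apply/Hn/(IH' _ _ _ _ He Hrf ea)/Hm => //; apply/(HH _ _ _ _ Hrf ea).
apply/(IH' _ _ _ _ He Hrf ea); apply: contrapT => Hn'; apply: Hn.
by exists a; split=> //; split=> //; apply/(HH _ _ _ _ Hrf ea).
Qed.

Lemma tc_expressible_Tc qs phi : mso_recognized phi -> tc_expressible (Tc qs phi).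
Proof.
move=> [L [recL HL]].
(* C dominates every endpoint of the prefix, so the regions up to C decide all its intervals. *)
pose C := \max_(q <- qs) max_endpoint q.2.
have HC : all (fun q => max_endpoint q.2 <= C) qs.
  rewrite /C; elim: qs {C} => //= q qs IH; rewrite big_cons leq_maxl /=.
  by apply: sub_all IH => r; rewrite leq_max => ->; rewrite orbT.
have [] := @metric_recognized (fun rho e => mso_sat e (fun=> set0) phi) L C qs 1 isT HC recL.
  by move=> rho rf e He; apply: HL.
move=> L' [[M [f [op [P [f_cat f_letter HP]]]]] HL'].
apply: eq_expressible (expressible_definable P
  (definable_anchored_word C f_cat f_letter)) => -[rho i] /=.
rewrite -HP; symmetry.
by apply: (HL' rho (fun k => region C (tau k - tau i)%R) (fun=> i)).
Qed.

(** Covers letters as well as nested time constraints: once translated, a nested constraint is a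
    RatMTL property of a single position. *)
Lemma recognized_atom p (K : @point R Sigma -> Prop) phi : expressible K ->
  (forall rho (e : nat -> position rho) E, mso_sat e E phi <-> K (at_pos (e p))) ->
  mso_recognized phi.
Proof.
move=> HK Hphi; exists (has (fun l => `[< K (l_pt l) >] && l_fo l p)); split.
  exact/recognizable_has/letter_definable_at.
move=> rho rf e E He.
rewrite Hphi (has_env_word_at _ _ (fun l => `[< K (l_pt l) >]) (He p)) /=.
by split=> /asboolP.
Qed.

Lemma qk_translation k :
  (forall phi, qk_mso k phi -> mso_recognized phi) /\
  (forall psi, qk_tc k psi -> tc_expressible psi).
Proof.
apply: mso_tcform_mutind => /=.
- move=> p q _; exists (has (fun l => l_fo l q && l_fo l p)); split.
    exact/recognizable_has/(letter_definable_marks (fun fo _ _ => fo q && fo p)).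
  move=> rho rf e E He.
  rewrite (has_env_word_at _ _ (fun l => l_fo l q) (He p)) /=.
  by split=> [->|/eqP].
- move=> p q _; exists (before (fun l => l_fo l p) (fun l => l_fo l q)); split.
    exact: (recognizable_before (letter_definable_marks (fun fo _ _ => fo p))
      (letter_definable_marks (fun fo _ _ => fo q))).
  move=> rho rf e E He; rewrite before_suffix /=.
  split=> [pq|[i [j [_ ij /eqP-> /eqP->]]] //].
  by exists (e p), (e q); rewrite !eqxx.
- move=> a p _.
  apply: (@recognized_atom p (fun x => a \in sigma (projT2 x))) => //.
  by exists (Atom a).
- move=> i p _; exists (has (fun l => l_so l i && l_fo l p)); split.
    exact/recognizable_has/(letter_definable_marks (fun fo so _ => so i && fo p)).
  move=> rho rf e E He.
  by rewrite (has_env_word_at _ _ (fun l => l_so l i) (He p)).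
- move=> f IHf g IHg /andP[/IHf [L [recL HL]] /IHg [L' [recL' HL']]].
  exists (fun w => L w /\ L' w); split; first exact: recognizable_and.
  by move=> rho rf e E He; rewrite /= (HL _ rf) // (HL' _ rf).
- move=> f IHf /IHf [L [recL HL]]; exists (fun w => ~ L w); split.
    exact: recognizable_not.
  by move=> rho rf e E He; rewrite /= (HL _ rf).
- move=> p f IHf /andP[p0 /IHf [L [recL HL]]].
  (* [ex_fo] also ranges over the anchor itself. That choice puts the marks 0 and p on the same
     letter, so excluding [H] makes the bound strict. *)
  pose H := has (fun l : @letter R Sigma => l_fo l 0 && l_fo l p).
  exists (ex_fo p (fun w => ~ H w /\ L w)); split.
    apply/recognizable_ex_fo/recognizable_and => //; apply/recognizable_not.
    exact/recognizable_has/(letter_definable_marks (fun fo _ _ => fo 0 && fo p)).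
  move=> rho rf e E He; rewrite ex_foP.
  have E0 a : upd e p a 0 = e 0 by rewrite upd_other // eq_sym.
  have HH (a : position rho) : e 0 <= a ->
      H (env_word rf (e 0) (upd e p a) E) <-> e 0 = a.
    move=> ea; have ea' : e 0 <= upd e p a p by rewrite upd_same.
    rewrite (has_env_word_at _ _ (fun l => l_fo l 0) ea') /= upd_same E0.
    by split=> [/eqP|->].
  have HL' (a : position rho) : e 0 <= a ->
      mso_sat (upd e p a) E f <-> L (env_word rf (e 0) (upd e p a) E).
    by move=> ea; rewrite -{1}(E0 a); apply: HL; apply: upd_ge; rewrite ?lt0n.
  split=> -[a].
    case=> ea Hf; have ea' := ltnW ea; exists a; split=> //; split; last exact/HL'.
    by rewrite HH // => Ea; rewrite Ea ltnn in ea.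
  case=> ea [Hn /(HL' _ ea) Hf]; exists a; split=> //.
  rewrite ltn_neqAle ea andbT; apply/eqP => Ea; apply: Hn; apply/HH => //.
  exact: val_inj.
- move=> i f IHf /IHf [L [recL HL]]; exists (ex_so i L); split.
    exact: recognizable_ex_so.
  move=> rho rf e E He; rewrite ex_soP.
  by split=> -[A HA]; exists A; apply/(HL _ rf e (upd E i A) He).
- by move=> psi IH p /IH Hpsi; apply: (@recognized_atom p _ _ Hpsi).
- by move=> qs f IHf /and4P[_ _ _ /IHf]; apply: tc_expressible_Tc.
Qed.

End QkMSOToRatMTL.

(** * Properties expressible in QkMSO *)

Lemma qk_mono (Sigma : finType) k k' : k <= k' ->
  (forall phi : mso Sigma, qk_mso k phi -> qk_mso k' phi) /\
  (forall psi : tcform Sigma, qk_tc k psi -> qk_tc k' psi).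
Proof.
move=> kk'; apply: mso_tcform_mutind => //=.
- by move=> f IHf g IHg /andP[/IHf-> /IHg->].
- by move=> p f IH /andP[-> /IH].
- by move=> qs f IH /and4P[qk -> -> /IH->]; rewrite (leq_trans qk kk').
Qed.

Section MsoExpressible.
Context {R : realType} {Sigma : finType}.
Implicit Types (rho : timed_word R Sigma) (n m x y : nat).

Definition block_start rho (i : position rho) :=
  forall k : position rho, tau k = tau i -> i <= k.

Definition anchored n rho (e : nat -> position rho) :=
  block_start (e 0) /\ forall p, p < n -> e 0 <= e p.

Definition env_pred := forall rho,
  (nat -> position rho) -> (nat -> {set position rho}) -> Prop.

(* Equivalence is only required when the anchor is the first position of its
   time stamp: from such an anchor every position with a time stamp at least
   that of the anchor is visible. *)
Definition mso_expressible n m (K : env_pred) :=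
  exists k (phi : mso Sigma),
    [/\ all (fun p => p < n) (fo_free phi), all (fun i => i < m) (so_free phi),
        qk_mso k phi
      & forall rho e E, anchored n e -> mso_sat e E phi <-> K rho e E].

(** All n and m are allowed, so that the property can be used under any number of further
    quantifiers. *)
Definition expressible1 (D : forall rho, position rho -> Prop) :=
  forall n m x, x < n -> mso_expressible n m (fun rho e _ => D rho (e x)).
Definition expressible2 (D : forall rho, position rho -> position rho -> Prop) :=
  forall n m x y, x < n -> y < n ->
    mso_expressible n m (fun rho e _ => D rho (e x) (e y)).

Definition tc_definable (K : forall rho, position rho -> Prop) :=
  exists k (psi : tcform Sigma), qk_tc k psi /\
    forall rho (a : position rho), block_start a -> tc_sat a psi <-> K rho a.

Lemma eq_mso_expressible n m (K K' : env_pred) :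
  (forall rho e E, anchored n e -> K rho e E <-> K' rho e E) ->
  mso_expressible n m K -> mso_expressible n m K'.
Proof.
move=> EK [k [phi [H1 H2 H3 H4]]]; exists k, phi; split=> // rho e E He.
by rewrite H4 // EK.
Qed.

Lemma mso_expressible_not n m K : mso_expressible n m K ->
  mso_expressible n m (fun rho e E => ~ K rho e E).
Proof.
move=> [k [phi [H1 H2 H3 H4]]]; exists k, (MNot phi); split=> // rho e E He /=.
by rewrite H4.
Qed.

Lemma mso_expressible_and n m K K' :
  mso_expressible n m K -> mso_expressible n m K' ->
  mso_expressible n m (fun rho e E => K rho e E /\ K' rho e E).
Proof.
move=> [k [f [H1 H2 H3 H4]]] [k' [f' [H1' H2' H3' H4']]].
exists (maxn k k'), (MAnd f f'); split=> /=; rewrite ?all_cat ?H1 ?H2 //.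
  by rewrite ((qk_mono _ (leq_maxl _ _)).1 _ H3) ((qk_mono _ (leq_maxr _ _)).1 _ H3').
by move=> rho e E He /=; rewrite H4 // H4'.
Qed.

Lemma mso_expressible_or n m K K' :
  mso_expressible n m K -> mso_expressible n m K' ->
  mso_expressible n m (fun rho e E => K rho e E \/ K' rho e E).
Proof.
move=> /mso_expressible_not H /mso_expressible_not H'.
apply: eq_mso_expressible (mso_expressible_not (mso_expressible_and H H')) => rho e E _.
by rewrite -not_orE; split=> [/contrapT|H1 H2].
Qed.

Lemma mso_expressible_imply n m K K' :
  mso_expressible n m K -> mso_expressible n m K' ->
  mso_expressible n m (fun rho e E => K rho e E -> K' rho e E).
Proof.
move=> /mso_expressible_not H H'.
apply: eq_mso_expressible (mso_expressible_or H H') => rho e E _.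
split=> [[//|//]|H1]; have [/H1|] := pselect (K rho e E); by [right|left].
Qed.

Lemma mso_expressible_eq n m x y : x < n -> y < n ->
  mso_expressible n m (fun rho e _ => e x = e y).
Proof. by move=> xn yn; exists 0, (MEq _ x y); split=> //=; rewrite xn yn. Qed.

Lemma mso_expressible_lt n m x y : x < n -> y < n ->
  mso_expressible n m (fun rho e _ => e x < e y).
Proof. by move=> xn yn; exists 0, (MLt _ x y); split=> //=; rewrite xn yn. Qed.

Lemma mso_expressible_le n m x y : x < n -> y < n ->
  mso_expressible n m (fun rho e _ => e x <= e y).
Proof.
move=> xn yn.
apply: eq_mso_expressible (mso_expressible_not (mso_expressible_lt m yn xn)).
by move=> rho e E _; rewrite (leqNgt (e x)); split=> /negP.
Qed.

Lemma mso_expressible_in n m x i : x < n -> i < m ->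
  mso_expressible n m (fun rho e E => e x \in E i).
Proof. by move=> xn im; exists 0, (MIn _ i x); split=> //=; rewrite ?xn ?im. Qed.

Lemma mso_expressible_const n m (c : Prop) : 0 < n ->
  mso_expressible n m (fun _ _ _ => c).
Proof.
move=> n0; have T := mso_expressible_eq m n0 n0.
have [Hc|Hc] := pselect c; first by apply: eq_mso_expressible T.
by apply: eq_mso_expressible (mso_expressible_not T) => rho e E _; split=> // /(_ erefl).
Qed.

Lemma mso_expressible_exlist (T : Type) (s : seq T) n m (K : T -> env_pred) :
  0 < n -> (forall t, mso_expressible n m (K t)) ->
  mso_expressible n m (fun rho e E => exists t, List.In t s /\ K t rho e E).
Proof.
move=> n0 HK; elim: s => [|t s IH].
  apply: eq_mso_expressible (mso_expressible_const m False n0) => rho e E _.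
  by split=> // -[t []].
apply: eq_mso_expressible (mso_expressible_or (HK t) IH) => rho e E _ /=; split.
  by case=> [Kt|[u [us Ku]]]; [exists t; split; [left|]|exists u; split; [right|]].
by case=> u [[<-|us] Ku]; [left|right; exists u].
Qed.

Lemma upd_lt (A : Type) (e : nat -> A) n x a : x < n -> upd e n a x = e x.
Proof. by move=> xn; rewrite upd_other // neq_ltn xn. Qed.

(** [MEx] only reaches positions strictly after the anchor, so the anchor is added as the disjunct
    [K] at variable 0. The bound variable n is fresh: [K] does not depend on it. *)
Lemma mso_expressible_ex n m
    (K : forall rho, (nat -> position rho) -> (nat -> {set position rho}) ->
       position rho -> Prop) :
  0 < n -> (forall rho e E a b, K rho (upd e n b) E a <-> K rho e E a) ->
  (forall n' x, n <= n' -> x < n' ->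
     mso_expressible n' m (fun rho e E => K rho e E (e x))) ->
  mso_expressible n m
    (fun rho e E => exists a : position rho, e 0 <= a /\ K rho e E a).
Proof.
move=> n0 Kupd HK; have H0 := HK _ _ (leqnn n) n0.
have [k [phi [H1 H2 H3 H4]]] := HK _ _ (leqnSn n) (ltnSn n).
have H : mso_expressible n m
    (fun rho e E => exists a : position rho, e 0 < a /\ K rho e E a).
  exists k, (MEx n phi); split=> //=.
  - rewrite n0 all_filter; apply: sub_all H1 => p pn.
    by apply/implyP => np; rewrite ltn_neqAle np -ltnS.
  - by rewrite -lt0n n0.
  move=> rho e E [He1 He2].
  have H5 (a : position rho) : e 0 < a -> mso_sat (upd e n a) E phi <-> K rho e E a.
    move=> ea; rewrite H4 ?upd_same; first exact: Kupd.
    rewrite /anchored !upd_lt //; split=> // p; rewrite ltnS leq_eqVlt.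
    by case/orP=> [/eqP->|pn]; rewrite ?upd_same ?upd_lt ?He2 // ltnW.
  by split=> -[a [ea Ha]]; exists a; split=> //; apply/H5.
apply: eq_mso_expressible (mso_expressible_or H0 H) => rho e E _; split.
  case=> [H5|[a [ea Ha]]]; first by exists (e 0).
  by exists a; split=> //; apply: ltnW.
case=> a []; rewrite leq_eqVlt => /orP[/eqP/val_inj <-|ea] Ha; first by left.
by right; exists a.
Qed.

Lemma mso_expressible_all n m
    (K : forall rho, (nat -> position rho) -> (nat -> {set position rho}) ->
       position rho -> Prop) :
  0 < n -> (forall rho e E a b, K rho (upd e n b) E a <-> K rho e E a) ->
  (forall n' x, n <= n' -> x < n' ->
     mso_expressible n' m (fun rho e E => K rho e E (e x))) ->
  mso_expressible n m
    (fun rho e E => forall a : position rho, e 0 <= a -> K rho e E a).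
Proof.
move=> n0 Kupd HK.
have H : mso_expressible n m (fun rho e E =>
    exists a : position rho, e 0 <= a /\ ~ K rho e E a).
  apply: mso_expressible_ex => // [rho e E a b|n' x nn' xn'].
    by rewrite Kupd.
  by apply: mso_expressible_not; apply: HK.
apply: eq_mso_expressible (mso_expressible_not H) => rho e E _.
split=> [H1 a ea|H1 [a [ea]]]; last by apply; apply: H1.
by apply: contrapT => Ha; apply: H1; exists a.
Qed.

Lemma mso_expressible_allset n m
    (K : forall rho, (nat -> position rho) -> (nat -> {set position rho}) ->
       {set position rho} -> Prop) :
  (forall rho e E A B, K rho e (upd E m B) A <-> K rho e E A) ->
  mso_expressible n m.+1 (fun rho e E => K rho e E (E m)) ->
  mso_expressible n m (fun rho e E => forall A, K rho e E A).
Proof.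
move=> Kupd /mso_expressible_not [k [phi [H1 H2 H3 H4]]].
have H : mso_expressible n m (fun rho e E => exists A, ~ K rho e E A).
  exists k, (MExSet m phi); split=> //=.
    rewrite all_filter; apply: sub_all H2 => p pn.
    by apply/implyP => np; rewrite ltn_neqAle np -ltnS.
  move=> rho e E He.
  have H5 A : mso_sat e (upd E m A) phi <-> ~ K rho e E A.
    by rewrite H4 // upd_same Kupd.
  by split=> -[A HA]; exists A; apply/H5.
apply: eq_mso_expressible (mso_expressible_not H) => rho e E _.
split=> [H5 A|H5 [A]]; last by apply.
by apply: contrapT => HA; apply: H5; exists A.
Qed.

(** The prefix only produces valuations that keep the anchor and stay at or after it, so agreement
    of the bodies on these suffices. *)
Lemma metric_sat_iff rho (K K' : (nat -> position rho) -> Prop) (a0 : position rho) :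
  (forall e, e 0 = a0 -> (forall p, a0 <= e p) -> K e <-> K' e) ->
  forall qs i e, 0 < i -> e 0 = a0 -> (forall p, a0 <= e p) ->
    metric_sat K qs i e <-> metric_sat K' qs i e.
Proof.
move=> HK; elim=> [|[q J] qs IH] i e i0 e0 He; first exact: HK.
have H (a : position rho) : a0 <= a ->
    metric_sat K qs i.+1 (upd e i a) <-> metric_sat K' qs i.+1 (upd e i a).
  move=> ea; apply: IH => // [|p]; first by rewrite upd_lt.
  by rewrite /upd; case: eqP.
case: q => /=; rewrite e0.
  by split=> -[a [ea Ja Ha]]; exists a; split=> //; apply/H.
by split=> Ha a ea Ja; apply/(H a ea); apply: Ha.
Qed.

Lemma tc_definable_metric qs (K : env_pred) :
  mso_expressible (size qs).+1 0 K ->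
  tc_definable (fun rho a =>
    metric_sat (fun e => K rho e (fun=> set0)) qs 1 (fun=> a)).
Proof.
move=> [k [phi [H1 H2 H3 H4]]].
exists (maxn k (size qs).+1), (Tc qs phi); split=> /=.
  rewrite leq_maxr H1 ((qk_mono _ (leq_maxl _ _)).1 _ H3) andbT.
  by case: (so_free phi) H2.
move=> rho a Ha; apply: (@metric_sat_iff _ _ _ a) => // e e0 He.
by apply: H4; rewrite /anchored e0.
Qed.

Lemma tc_definable_base (K : forall rho, position rho -> Prop) :
  mso_expressible 1 0 (fun rho e _ => K rho (e 0)) -> tc_definable K.
Proof. exact: (@tc_definable_metric [::] (fun rho e _ => K rho (e 0))). Qed.

End MsoExpressible.

(** * Blocks of positions with equal time stamps *)

Section Blocks.
Context {R : realType} {Sigma : finType}.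
Implicit Types (rho : timed_word R Sigma) (n m x y : nat).

Definition block_end rho (i : position rho) :=
  forall k : position rho, tau k = tau i -> k <= i.

Definition same_time rho (i j : position rho) := i <= j /\ tau i = tau j.

Lemma block_start_exists rho (i : position rho) :
  exists b : position rho, block_start b /\ same_time b i.
Proof.
have Pi : tau i == tau i by [].
have [b /eqP Eb Hb] := @arg_minnP _ i (fun j : position rho => tau j == tau i) val Pi.
by exists b; split=> [k Ek|]; [|split=> //]; apply: Hb; rewrite ?Ek ?Eb.
Qed.

Lemma block_end_exists rho (i : position rho) :
  exists l : position rho, block_end l /\ same_time i l.
Proof.
have Pi : tau i == tau i by [].
have [b /eqP Eb Hb] := @arg_maxnP _ i (fun j : position rho => tau j == tau i) val Pi.
by exists b; split=> [k Ek|]; [|split=> //]; apply: Hb; rewrite ?Ek ?Eb.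
Qed.

Lemma tc_mso_expressible n m x k (psi : tcform Sigma)
    (K : forall rho, position rho -> Prop) :
  x < n -> qk_tc k psi -> (forall rho (a : position rho), tc_sat a psi <-> K rho a) ->
  mso_expressible n m (fun rho e _ => K rho (e x)).
Proof.
by move=> xn Hpsi HK; exists k, (MTc psi x); split=> //=; rewrite xn.
Qed.

(** The negation only looks forward: a nested constraint anchored at the position itself asks for a
    later position at distance 0. *)
Lemma block_end_expressible : expressible1 (R := R) (Sigma := Sigma) block_end.
Proof.
move=> n m x xn; pose J := TInterval true 0 (Some 0) true.
pose K rho (i : position rho) := exists a : position rho, i < a /\ tau a = tau i.
have H : mso_expressible n m (fun rho e _ => K rho (e x)).
  apply: (@tc_mso_expressible _ _ _ 2 (Tc [:: (MQexists, J)] (MLt _ 0 1))) => //.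
  move=> rho i; split=> /= [[a [ia]]|[a [ia Ea]]].
    by rewrite in_point0 subr_eq0 => /eqP Ea H; exists a.
  by exists a; rewrite ltnW // in_point0 Ea subrr.
apply: eq_mso_expressible (mso_expressible_not H) => rho e E _.
split=> [H1 k Ek|H1 [a [ea /H1]]]; last by rewrite leqNgt ea.
by rewrite leqNgt; apply/negP => xk; apply: H1; exists k.
Qed.

(** MSO does not compare time stamps, but two positions share theirs exactly when no block ends
    between them, the first included and the second excluded. *)
Lemma same_time_expressible : expressible2 (R := R) (Sigma := Sigma) same_time.
Proof.
move=> n m x y xn yn; have n0 : 0 < n by lia.
have H : mso_expressible n m (fun rho e _ => forall z : position rho, e 0 <= z ->
    e x <= z -> z < e y -> ~ block_end z).
  apply: mso_expressible_all => // [rho e _ a b|n' z nn' zn'].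
    by rewrite !upd_lt.
  have xn' := leq_trans xn nn'; have yn' := leq_trans yn nn'.
  apply: mso_expressible_imply; first exact: mso_expressible_le.
  apply: mso_expressible_imply; first exact: mso_expressible_lt.
  exact/mso_expressible_not/block_end_expressible.
apply: eq_mso_expressible (mso_expressible_and (mso_expressible_le m xn yn) H).
move=> rho e E [He1 He2]; split=> -[exy H1]; split=> //; last first.
  move=> z _ xz zy /(_ (e y)); rewrite -H1 leqNgt zy.
  suff -> : tau (e x) = tau z by move/(_ erefl).
  by apply: le_anti; rewrite tau_le // H1 tau_le // ltnW.
(* Walking from [e x] one step at a time: the predecessor z' of z is not a block end, so some later
   position, hence also z, has its time stamp. *)
suff Hz d : forall z : position rho, z = e x + d :> nat -> z <= e y -> tau (e x) = tau z.
  by apply: (Hz (e y - e x)) => //; lia.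
elim: d => [|d IH] z Ez zy; first by have -> : z = e x by apply: val_inj => /=; lia.
have dn : e x + d < (tw_last rho).+1 by have := ltn_ord z; lia.
pose z' : position rho := Ordinal dn.
have Ez' : tau (e x) = tau z' by apply: IH => /=; lia.
have x0 := He2 x xn; have z'E : nat_of_ord z' = e x + d by [].
have Hne : ~ block_end z' by apply: H1; lia.
rewrite Ez'; apply: le_anti; rewrite (@tau_le _ _ _ z' z) /=; last by lia.
have [k [zk Ek]] : exists k : position rho, z' < k /\ tau k = tau z'.
  apply: contrapT => Hn; apply: Hne => k Ek.
  by rewrite leqNgt; apply/negP => zk; apply: Hn; exists k.
by rewrite -Ek tau_le //; lia.
Qed.

Lemma succ_expressible : expressible2 (R := R) (Sigma := Sigma)
  (fun rho (i j : position rho) => nat_of_ord j = i.+1).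
Proof.
move=> n m x y xn yn; have n0 : 0 < n by lia.
have H : mso_expressible n m (fun rho e _ => forall z : position rho, e 0 <= z ->
    e x < z -> e y <= z).
  apply: mso_expressible_all => // [rho e _ b c|n' z nn' zn'].
    by rewrite !upd_lt.
  have xn' := leq_trans xn nn'; have yn' := leq_trans yn nn'.
  apply: mso_expressible_imply; first exact: mso_expressible_lt.
  exact: mso_expressible_le.
apply: eq_mso_expressible (mso_expressible_and (mso_expressible_lt m xn yn) H).
move=> rho e E [He1 He2]; split=> [[xy Hz]|Ey]; last first.
  by split=> [|z _ xz]; lia.
have zn : (e x).+1 < (tw_last rho).+1 by have := ltn_ord (e y); lia.
by have := Hz (Ordinal zn) => /=; have := He2 x xn; lia.
Qed.

(** The quantifier misses the positions before the anchor, but as the anchor starts its block, none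
    of them shares a time stamp with a position at or after it. *)
Lemma block_start_expressible : expressible1 (R := R) (Sigma := Sigma) block_start.
Proof.
move=> n m x xn; have n0 : 0 < n by lia.
have H : mso_expressible n m (fun rho e _ => forall z : position rho, e 0 <= z ->
    z < e x -> ~ same_time z (e x)).
  apply: mso_expressible_all => // [rho e _ a b|n' z nn' zn'].
    by rewrite !upd_lt.
  have xn' := leq_trans xn nn'.
  apply: mso_expressible_imply; first exact: mso_expressible_lt.
  exact/mso_expressible_not/same_time_expressible.
apply: eq_mso_expressible H => rho e E [He1 He2]; split=> [H k Ek|H z ez zx [_ Ez]].
  rewrite leqNgt; apply/negP => kx; have [ek|ke] := leqP (e 0) k.
    by apply: (H k ek kx); split=> //; apply: ltnW.
  have := He1 k; rewrite leqNgt ke => /(_ _)/negP; apply => //.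
  apply: le_anti; rewrite (tau_le (ltnW ke)) Ek tau_le //; exact: He2.
by have := H z Ez; lia.
Qed.

(** The start of the block of i is visible from the anchor, so it can be quantified and the
    constraint evaluated there by [MTc]. *)
Lemma tc_definable_expressible (K : forall rho, position rho -> Prop) :
  tc_definable K ->
  expressible1 (fun rho i => exists b, [/\ block_start b, same_time b i & K rho b]).
Proof.
move=> [k [psi [Hpsi HK]]] n m x xn; have n0 : 0 < n by lia.
have H : mso_expressible n m (fun rho e _ => exists b : position rho, e 0 <= b /\
    (same_time b (e x) /\ (block_start b /\ tc_sat b psi))).
  apply: mso_expressible_ex => // [rho e _ a b|n' z nn' zn'].
    by rewrite !upd_lt.
  have xn' := leq_trans xn nn'.
  apply: mso_expressible_and; first exact: same_time_expressible.
  apply: mso_expressible_and; first exact: block_start_expressible.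
  exact: (tc_mso_expressible (K := fun rho z => tc_sat z psi) m zn' Hpsi).
apply: eq_mso_expressible H => rho e E [He1 He2]; split.
  by case=> b [eb [Hb [Hb1 Hb2]]]; exists b; split=> //; apply/HK.
case=> b [Hb1 Hb2 Hb3]; exists b; split; last by do 2 split=> //; apply/HK.
case: Hb2 => bx Eb; rewrite leqNgt; apply/negP => be.
have := He1 b; rewrite leqNgt be => /(_ _)/negP; apply => //.
by apply: le_anti; rewrite (tau_le (ltnW be)) Eb tau_le // He2.
Qed.

(** A block start is the start of its own block, so both constraints can be nested in one with empty
    prefix, whose body forms the disjunction. *)
Lemma tc_definable_or (K K' : forall rho, position rho -> Prop) :
  tc_definable (R := R) (Sigma := Sigma) K -> tc_definable K' ->
  tc_definable (fun rho i => K rho i \/ K' rho i).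
Proof.
move=> H H'; apply: tc_definable_base.
suff HK (L : forall rho, position rho -> Prop) : tc_definable (R := R) (Sigma := Sigma) L ->
    mso_expressible 1 0 (fun rho e _ => L rho (e 0)).
  exact: mso_expressible_or (HK _ H) (HK _ H').
move=> {H H'} /tc_definable_expressible/(_ 1 0 0 isT).
apply: eq_mso_expressible => rho e E [He1 _]; split; last by exists (e 0).
case=> b [Hb [b0 Eb] HL]; suff -> : e 0 = b by [].
by apply/val_inj/eqP; rewrite eqn_leq b0 He1.
Qed.

End Blocks.

(** * Matching a regular expression on a segment *)

Section Matching.
Context {R : realType} {Sigma : finType} {N : nat}.
Implicit Types (rho : timed_word R Sigma) (n m x y : nat) (r s : regex 'I_N).
Context (K : 'I_N -> forall rho, position rho -> Prop).

(** Ranges of natural numbers make cutting a segment a matter of arithmetic; [inord] is exact on the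
    ranges i < k <= j used in [matches]. *)
Definition labels rho i l : seq ('I_N -> Prop) :=
  [seq (fun a => K a (inord k : position rho)) | k <- iota i l].

(* Half-open: i is excluded, j included. *)
Definition matches r rho (i j : position rho) :=
  i <= j /\ exists w, single (labels rho i.+1 (j - i)) w /\ re_lang r w.

Lemma single_cat (A : Type) (u v : seq (A -> Prop)) w : single (u ++ v) w <->
  exists w1 w2, [/\ w = w1 ++ w2, single u w1 & single v w2].
Proof.
elim: u w => [|U u IH] w /=; split.
- by move=> Hw; exists [::], w.
- by case=> -[|x w1] [w2 [-> //]].
- case: w => [//|x w] [Ux /IH [w1 [w2 [-> H1 H2]]]].
  by exists (x :: w1), w2.
- case=> -[|x w1] [w2 [-> //= [Ux H1] H2]]; split=> //.
  by apply/IH; exists w1, w2.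
Qed.

Lemma single_size (A : Type) (u : seq (A -> Prop)) w : single u w -> size w = size u.
Proof. by elim: u w => [|U u IH] [|x w] //= [_ /IH ->]. Qed.

Lemma labels_cat rho i l l' : labels rho i (l + l') = labels rho i l ++ labels rho (i + l) l'.
Proof. by rewrite /labels iotaD map_cat. Qed.

Lemma single_labels_cat rho (i j : position rho) u v : i <= j ->
  single (labels rho i.+1 (j - i)) (u ++ v) ->
  exists l : position rho, [/\ i <= l, l <= j,
    single (labels rho i.+1 (l - i)) u & single (labels rho l.+1 (j - l)) v].
Proof.
move=> ij Hs; have Huv := single_size Hs.
rewrite size_cat size_map size_iota in Huv.
have ln : i + size u < (tw_last rho).+1 by have := ltn_ord j; lia.
(* As i is excluded from the segment, the cut is exactly i + [size u], which is i itself when u is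
   empty. *)
exists (Ordinal ln); rewrite /= leq_addr; split=> //; first by lia.
  move: Hs; have -> : j - i = size u + size v by lia.
  rewrite labels_cat => /single_cat [w1 [w2 [Ew H1 H2]]].
  have E1 := single_size H1; rewrite size_map size_iota in E1.
  move/eqP: Ew; rewrite eqseq_cat // => /andP[/eqP Eu _].
  by rewrite addKn; move: H1; rewrite -Eu.
move: Hs; have -> : j - i = size u + size v by lia.
rewrite labels_cat => /single_cat [w1 [w2 [Ew H1 H2]]].
have E1 := single_size H1; rewrite size_map size_iota in E1.
move/eqP: Ew; rewrite eqseq_cat // => /andP[_ /eqP Ev].
by have -> : j - (i + size u) = size v by [lia]; move: H2; rewrite -Ev.
Qed.

Lemma matches_cat rho (i l j : position rho) u v : i <= l -> l <= j ->
  single (labels rho i.+1 (l - i)) u -> single (labels rho l.+1 (j - l)) v ->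
  single (labels rho i.+1 (j - i)) (u ++ v).
Proof.
move=> il lj Hu Hv; have -> : j - i = (l - i) + (j - l) by lia.
rewrite labels_cat; apply/single_cat; exists u, v; split=> //.
by have -> : i.+1 + (l - i) = l.+1 by lia.
Qed.

Lemma matches_split r rho (i l j : position rho) : i <= l -> l <= j ->
  matches r i j <-> exists p, List.In p (re_split r) /\
    (matches p.1 i l /\ matches p.2 l j).
Proof.
move=> il lj; split.
  case=> ij [w []]; have -> : j - i = (l - i) + (j - l) by lia.
  rewrite labels_cat => /single_cat [u [v [-> Hu Hv]]] /re_splitP [p [Hp Hpu Hpv]].
  exists p; split=> //; split; split=> //; [by exists u|exists v; split=> //].
  by have -> : l.+1 = i.+1 + (l - i) by lia.
case=> p [Hp [[_ [u [Hu Hpu]]] [_ [v [Hv Hpv]]]]]; split; first exact: leq_trans lj.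
exists (u ++ v); split; first exact: matches_cat Hu Hv.
by apply/re_splitP; exists p.
Qed.

Lemma matches_concat r s rho (i j : position rho) :
  matches (RConcat r s) i j <->
  exists l : position rho, i <= l /\ (matches r i l /\ matches s l j).
Proof.
split.
  case=> ij [w [Hs /re_concatP [u [v [Ew Hu Hv]]]]].
  move: Hs; rewrite Ew => /(single_labels_cat ij) [l [il lj Hsu Hsv]].
  by exists l; split=> //; split; split=> //; [exists u|exists v].
case=> l [_ [[il [u [Hu Hru]]] [lj [v [Hv Hrv]]]]]; split; first exact: leq_trans lj.
by exists (u ++ v); split; [exact: matches_cat Hu Hv | exact: re_concat].
Qed.

Lemma matches_eps rho (i j : position rho) : matches (REps _) i j <-> i = j.
Proof.
split=> [[ij [w [Hs /re_epsP Ew]]]|->].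
  have := single_size Hs; rewrite Ew size_map size_iota /= => Eij.
  by apply: val_inj => /=; lia.
by split=> //; exists [::]; rewrite subnn; split=> //; constructor.
Qed.

Lemma matches_sym a rho (i j : position rho) : matches (RSym a) i j <->
  nat_of_ord j = i.+1 /\ K a j.
Proof.
split=> [[ij [w [Hs /re_symP Ew]]]|[Ej Ka]].
  have := single_size Hs; rewrite Ew size_map size_iota /= => Eij.
  have Ej : nat_of_ord j = i.+1 by lia.
  by move: Hs; rewrite Ew -Eij /= -Ej inord_val => -[].
split; first by lia.
exists [:: a]; split; last by constructor.
by rewrite Ej subSnn /= -Ej inord_val.
Qed.

(** The star is the reflexive transitive closure of matching [r]: j lies in every set that contains
    i and is closed under [r]-steps. Steps move forward, so it suffices to ask closure at positions
    from a0 on. *)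
Lemma matches_star r rho (a0 i j : position rho) : a0 <= i ->
  matches (RStar r) i j <-> forall A : {set position rho}, i \in A ->
    (forall u : position rho, a0 <= u -> forall v : position rho, a0 <= v ->
       u \in A -> matches r u v -> v \in A) -> j \in A.
Proof.
move=> ai; split.
  case=> ij [w [Hs Hw]] A iA HA; move: w Hw i ai ij Hs iA.
  apply: re_star_rect => [i ai ij /single_size|u v Hu Hv IH i ai ij].
    rewrite size_map size_iota /= => Eij.
    by have -> // : j = i by apply: val_inj => /=; lia.
  move=> /(single_labels_cat ij) [l [il lj Hsu Hsv]] iA.
  have al := leq_trans ai il; apply: (IH l) => //.
  by apply: (HA i _ l) => //; split=> //; exists u.
(* Instantiated with the set of positions reached from i by the star, which is itself closed. *)
move=> /(_ [set v | `[< matches (RStar r) i v >]]); rewrite !inE => H.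
apply/asboolP; apply: H.
  by apply/asboolP; split=> //; exists [::]; rewrite subnn; split=> //; constructor.
move=> u _ v _; rewrite !inE => /asboolP [iu [w [Hw Hr]]] [uv [w' [Hw' Hr']]].
apply/asboolP; split; first exact: leq_trans uv.
exists (w ++ w'); split; first exact: matches_cat Hw Hw'.
by apply: re_star_cat => //; apply: re_star1.
Qed.

Hypothesis HK : forall a, expressible1 (K a).

Lemma matches_expressible r : expressible2 (@matches r).
Proof.
elim: r => [||a|r IHr s IHs|r IHr s IHs|r IHr] n m x y xn yn; have n0 : 0 < n by lia.
- apply: eq_mso_expressible (mso_expressible_const m False n0) => rho e E _.
  by split=> // -[_ [w [_ /re_emptyP]]].
- apply: eq_mso_expressible (mso_expressible_eq m xn yn) => rho e E _.
  by rewrite matches_eps.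
- have H := mso_expressible_and (succ_expressible m xn yn) (HK a m yn).
  by apply: eq_mso_expressible H => rho e E _; rewrite matches_sym.
- apply: eq_mso_expressible (mso_expressible_or (IHr n m x y xn yn) (IHs n m x y xn yn)).
  move=> rho e E _; split.
    by case=> -[xy [w [Hw Hr]]]; split=> //; exists w; split=> //;
      apply/re_unionP; [left|right].
  by case=> xy [w [Hw /re_unionP [] Hr]]; [left|right]; split=> //; exists w.
- have H : mso_expressible n m (fun rho e _ => exists z : position rho, e 0 <= z /\
      (matches r (e x) z /\ matches s z (e y))).
    apply: mso_expressible_ex => // [rho e _ b c|n' z nn' zn'].
      by rewrite !upd_lt.
    have xn' := leq_trans xn nn'; have yn' := leq_trans yn nn'.
    by apply: mso_expressible_and; [apply: IHr|apply: IHs].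
  apply: eq_mso_expressible H => rho e E [He1 He2]; rewrite matches_concat.
  split=> -[z [ez [H1 H2]]]; exists z; split=> //; first by case: H1.
  exact: leq_trans (He2 x xn) _.
- have H : mso_expressible n m (fun rho e E => forall A : {set position rho}, e x \in A ->
    (forall u : position rho, e 0 <= u -> forall v : position rho, e 0 <= v ->
       u \in A -> matches r u v -> v \in A) -> e y \in A).
    apply: mso_expressible_allset => //.
    apply: mso_expressible_imply; first exact: mso_expressible_in.
    apply: mso_expressible_imply; last exact: mso_expressible_in.
    apply: mso_expressible_all => // [rho e E b c|n' u nn' un'].
      by rewrite !upd_lt.
    have xn' := leq_trans xn nn'; have yn' := leq_trans yn nn'.
    apply: mso_expressible_all => // [|rho e E b c|n'' v nn'' vn'']; first by lia.
      by rewrite !upd_lt.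
    have un'' := leq_trans un' nn''.
    apply: mso_expressible_imply; first exact: mso_expressible_in.
    apply: mso_expressible_imply; first exact: IHr.
    exact: mso_expressible_in.
  apply: eq_mso_expressible H => rho e E [He1 He2].
  by rewrite (matches_star _ _ (He2 x xn)).
Qed.

End Matching.

(** * From RatMTL to QkMSO *)

Section Intervals.
Context {R : realType}.
Implicit Types (J : tinterval) (x y z : R).

Lemma in_tinterval_ge0 J x : in_tinterval J x -> (0 <= x)%R.
Proof.
rewrite /in_tinterval => /andP[+ _]; case: ifP => _.
  exact/le_trans.
by move/ltW; apply/le_trans.
Qed.

Lemma in_tinterval_convex J x y z : (x <= y)%R -> (y <= z)%R ->
  in_tinterval J x -> in_tinterval J z -> in_tinterval J y.
Proof.
rewrite /in_tinterval => xy yz /andP[Hx _] /andP[_ Hz]; apply/andP; split.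
  by move: Hx; case: ifP => _ Hx; [exact: le_trans xy | exact: lt_le_trans xy].
case: (hi J) Hz => // u; case: ifP => _ Hz; first exact: le_trans Hz.
exact: le_lt_trans Hz.
Qed.

End Intervals.

Lemma mem_In (T : eqType) (x : T) (s : seq T) : x \in s -> List.In x s.
Proof.
by elim: s => //= y s IH; rewrite inE => /orP[/eqP->|/IH]; [left|right].
Qed.

(** * [FRat] and [Rat] expressed from anchors at block starts *)

Section Operators.
Context {R : realType} {Sigma : finType} {N : nat}.
Implicit Types (rho : timed_word R Sigma) (n m x y : nat) (r s : regex 'I_N).
Implicit Type J : tinterval.
Context (K : 'I_N -> forall rho, position rho -> Prop).
Hypothesis HK : forall a, expressible1 (K a).
Local Notation lab rho := (fun (k : position rho) a => K a k).

Lemma filter_enum_iota rho a b : b <= (tw_last rho).+1 ->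
  [seq k : position rho <- enum (position rho) | a <= k < b] =
  [seq (inord k : position rho) | k <- iota a (b - a)].
Proof.
move=> bn; apply: (inj_map val_inj); rewrite -map_comp.
have -> : [seq (val \o (fun k => inord k : position rho)) k | k <- iota a (b - a)] =
    iota a (b - a).
  rewrite -[RHS]map_id; apply/eq_in_map => k; rewrite mem_iota => Hk /=.
  by rewrite inordK //; lia.
rewrite -(filter_map val (fun k => a <= k < b)) val_enum_ord.
apply: (irr_sorted_eq ltn_trans ltnn).
- by apply: sorted_filter; [exact: ltn_trans | exact: iota_ltn_sorted].
- exact: iota_ltn_sorted.
by move=> k; rewrite mem_filter !mem_iota; lia.
Qed.

(** [Seg] excludes both ends while [matches] includes the right one, hence the predecessor j' of
    j. *)
Definition open_matches r rho (i j : position rho) :=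
  exists j' : position rho, nat_of_ord j = j'.+1 /\ matches K r i j'.

Lemma open_matchesP r rho (i j : position rho) : open_matches r i j <->
  i < j /\ exists w, single (Seg (lab rho) i j) w /\ re_lang r w.
Proof.
have H (j' : position rho) : nat_of_ord j = j'.+1 ->
    Seg (lab rho) i j = labels K rho i.+1 (j' - i).
  move=> Ej; rewrite /Seg /labels filter_enum_iota; last by rewrite ltnW.
  by rewrite Ej subSS -map_comp.
split=> [[j' [Ej [ij Hw]]]|[ij Hw]]; first by rewrite (H j') // Ej ltnS.
have j'n : j.-1 < (tw_last rho).+1 by have := ltn_ord j; lia.
have Ej : nat_of_ord j = (Ordinal j'n : position rho).+1 by rewrite /=; lia.
exists (Ordinal j'n); split=> //; split; first by rewrite /=; lia.
by rewrite -H.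
Qed.

Lemma open_matches_expressible r : expressible2 (@open_matches r).
Proof.
move=> n m x y xn yn; have n0 : 0 < n by lia.
have H : mso_expressible n m (fun rho e _ => exists z : position rho, e 0 <= z /\
    (nat_of_ord (e y) = z.+1 /\ matches K r (e x) z)).
  apply: mso_expressible_ex => // [rho e _ b c|n' z nn' zn'].
    by rewrite !upd_lt.
  have xn' := leq_trans xn nn'; have yn' := leq_trans yn nn'.
  apply: mso_expressible_and; first exact: succ_expressible.
  exact: matches_expressible.
apply: eq_mso_expressible H => rho e E [He1 He2]; split.
  by case=> z [_ Hz]; exists z.
case=> z [Ez Hz]; exists z; split=> //.
by apply: leq_trans (He2 x xn) _; case: Hz.
Qed.

Lemma open_matches_split r rho (i l j : position rho) : i <= l -> l < j ->
  open_matches r i j <-> exists p, List.In p (re_split r) /\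
    (matches K p.1 i l /\ open_matches p.2 l j).
Proof.
move=> il lj; split.
  case=> j' [Ej Hj]; have lj' : l <= j' by lia.
  have [p [Hp [H1 H2]]] := (matches_split _ _ il lj').1 Hj.
  by exists p; split=> //; split=> //; exists j'.
case=> p [Hp [H1 [j' [Ej H2]]]]; exists j'; split=> //.
by apply/(matches_split _ _ il); [lia | exists p].
Qed.

Section FRat.
Context (J : tinterval) (r : regex 'I_N) (F : forall rho, position rho -> Prop).
Hypothesis HF : expressible1 F.

Definition frat_at rho (i : position rho) := exists j : position rho,
  [/\ F j, in_tinterval J (tau j - tau i)%R & open_matches r i j].

(** The part of the run beyond the end l of the block of b; b has the same clock as every position
    of its block. *)
Definition frat_after_block s rho (b : position rho) := exists j : position rho,
  [/\ b <= j, in_tinterval J (tau j - tau b)%R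
    & F j /\ exists l : position rho, b <= l /\
        (same_time b l /\ (block_end l /\ open_matches s l j))].

Lemma frat_after_block_definable s : tc_definable (@frat_after_block s).
Proof.
pose L : @env_pred R Sigma := fun rho e _ => F (e 1) /\
  exists l : position rho, e 0 <= l /\
    (same_time (e 0) l /\ (block_end l /\ open_matches s l (e 1))).
apply: (@tc_definable_metric _ _ [:: (MQexists, J)] L) => /=.
apply: mso_expressible_and; first exact: HF.
apply: mso_expressible_ex => // n' z nn' zn'.
apply: mso_expressible_and; first by apply: same_time_expressible => //; lia.
apply: mso_expressible_and; first exact: block_end_expressible.
exact: open_matches_expressible.
Qed.

(* A target within the block of i is in view of any earlier anchor.  Otherwise
   the run is split at the end l of the block: the part after l, including the
   time constraint, only depends on the start of the block. *)
Lemma frat_expressible : expressible1 frat_at.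
Proof.
move=> n m x xn; have n0 : 0 < n by lia.
(* Within the block the distance is 0, so the time constraint is the fixed condition that 0 lies in
   J. *)
have HA : mso_expressible n m (fun rho e _ => in_tinterval J (0 : R)%R /\
    exists j : position rho, e 0 <= j /\
      (F j /\ (same_time (e x) j /\ open_matches r (e x) j))).
  apply: mso_expressible_and; first exact: mso_expressible_const.
  apply: mso_expressible_ex => // [rho e _ b c|n' z nn' zn'].
    by rewrite !upd_lt.
  have xn' := leq_trans xn nn'.
  apply: mso_expressible_and; first exact: HF.
  apply: mso_expressible_and; first exact: same_time_expressible.
  exact: open_matches_expressible.
have HB : mso_expressible n m (fun rho e _ => exists l : position rho, e 0 <= l /\
    (same_time (e x) l /\ (block_end l /\ exists p, List.In p (re_split r) /\
      (matches K p.1 (e x) l /\ exists b,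
        [/\ block_start b, same_time b (e x) & frat_after_block p.2 b])))).
  apply: mso_expressible_ex => // [rho e _ b c|n' z nn' zn'].
    by rewrite !upd_lt.
  have xn' := leq_trans xn nn'; have n'0 := leq_trans n0 nn'.
  apply: mso_expressible_and; first exact: same_time_expressible.
  apply: mso_expressible_and; first exact: block_end_expressible.
  apply: mso_expressible_exlist => // p.
  apply: mso_expressible_and; first exact: matches_expressible.
  exact: tc_definable_expressible (frat_after_block_definable p.2) _ _ _ xn'.
apply: eq_mso_expressible (mso_expressible_or HA HB) => rho e E [He1 He2].
move: (e x) (He2 x xn) => i ei; split.
  case=> [[J0 [j [_ [Fj [[_ Ej] Hj]]]]]|].
    by exists j; split=> //; rewrite Ej subrr.
  case=> l [el [[il Eil] [Hl [p [Hp [Hpl [b [Hb [bi Ebi] []]]]]]]]].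
  move=> j [bj Jj [Fj [l' [_ [[bl' Ebl'] [Hl' Hj]]]]]].
  (* A block has a single end, so the one found from b is the one found from i. *)
  have El : l' = l.
    have H1 : l <= l' by apply: Hl'; rewrite -Eil -Ebi.
    have H2 : l' <= l by apply: Hl; rewrite -Eil -Ebi.
    by apply: val_inj => /=; lia.
  rewrite {l' bl' Ebl' Hl'}El in Hj; exists j; split=> //; first by rewrite -Ebi.
  by apply/(open_matches_split _ il); [case/open_matchesP: Hj | exists p].
case=> j [Fj Jj Hj]; have [ij _] := (open_matchesP _ _ _).1 Hj.
have [Eij|neq] := eqVneq (tau i) (tau j).
  left; split; first by rewrite -(subrr (tau j)) -{2}Eij.
  exists j; split; first by lia.
  by split=> //; split=> //; split=> //; apply: ltnW.
right; have [l [Hl [il Eil]]] := block_end_exists i.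
have [b [Hb [bi Ebi]]] := block_start_exists i.
have lj : l < j.
  apply: tau_lt_pos; rewrite -Eil lt_neqAle neq tau_le //; exact: ltnW.
have [p [Hp [Hpl Hlj]]] := (open_matches_split _ il lj).1 Hj.
exists l; split; first by lia.
do 2 split=> //; exists p; split=> //; split=> //; exists b; split=> //.
exists j; split; [lia | by rewrite Ebi |].
split=> //; exists l; split; first by lia.
by split; [split; [lia | rewrite Ebi] | split].
Qed.

End FRat.

Definition rat_at J r rho (i : position rho) :=
  exists w, single (TSeg (lab rho) J i) w /\ re_lang r w.

(** Intervals are convex, so the window is the whole range from its first position t1 to its last
    position t2. The label of t1 stands apart because [matches] from t1 excludes it. *)
Lemma TSeg_labels J rho (b t1 t2 : position rho) :
  in_tinterval J (tau t1 - tau b)%R -> in_tinterval J (tau t2 - tau b)%R ->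
  (forall k : position rho, in_tinterval J (tau k - tau b)%R -> t1 <= k /\ k <= t2) ->
  t1 <= t2 ->
  TSeg (lab rho) J b = (fun a => K a t1) :: labels K rho t1.+1 (t2 - t1).
Proof.
move=> J1 J2 Jk t12.
rewrite /TSeg (eq_filter (a2 := fun k : position rho => t1 <= k < t2.+1)).
  rewrite filter_enum_iota // subSn //= -map_comp /labels; congr (_ :: _).
  by rewrite /= inord_val.
move=> k; apply/idP/andP => [/Jk []//|[]]; rewrite ltnS => tk kt.
by apply: in_tinterval_convex J1 J2; rewrite lerD2r tau_le.
Qed.

(** Seen from a block start the window never looks back. Either it is empty and [r] accepts the
    empty word, or its first and last positions are guessed by metric quantifiers and [r] is matched
    between them. *)
Lemma rat_definable J r : tc_definable (@rat_at J r).
Proof.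
pose K1 rho (b : position rho) := re_lang r [::] /\ forall k : position rho, b <= k ->
  in_tinterval J (tau k - tau b)%R -> False.
have H1 : tc_definable K1.
  have [Hr|Hr] := pselect (re_lang r [::]); last first.
    apply: tc_definable_base.
    apply: (@eq_mso_expressible _ _ 1 0 (fun _ _ _ => False)).
      by move=> rho e E _; split=> // -[].
    exact: mso_expressible_const.
  (* A universal metric quantifier with a false body says that the window is empty. *)
  have [k [psi [Hpsi H]]] := @tc_definable_metric R Sigma [:: (MQforall, J)]
    (fun _ _ _ => False) (@mso_expressible_const _ _ 2 0 False isT).
  by exists k, psi; split=> // rho a Ha; rewrite H //=; split=> [|[]].
(* t_1 and t_2 are the ends of the window, as certified by the universal t_3. [re_split] separates
   the letter a read at t_1 from the rest. *)
pose L : @env_pred R Sigma := fun rho e _ => (e 1 <= e 3 /\ e 3 <= e 2) /\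
  exists p, List.In p (re_split r) /\ exists a, List.In a (enum 'I_N) /\
    (re_lang p.1 [:: a] /\ (K a (e 1) /\ matches K p.2 (e 1) (e 2))).
have HL : mso_expressible 4 0 L.
  apply: mso_expressible_and.
    by apply: mso_expressible_and; apply: mso_expressible_le.
  apply: mso_expressible_exlist => // p; apply: mso_expressible_exlist => // a.
  apply: mso_expressible_and; first exact: mso_expressible_const.
  apply: mso_expressible_and; first exact: HK.
  exact: matches_expressible.
have H2 := @tc_definable_metric _ _ [:: (MQexists, J); (MQexists, J); (MQforall, J)] L HL.
have [k [psi [Hpsi H]]] := tc_definable_or H1 H2.
exists k, psi; split=> // rho b Hb; rewrite H //= {k psi Hpsi H H1 H2 HL}.
(* Positions at distance 0 do not precede b, as b starts its block. *)
have Jb (k : position rho) : in_tinterval J (tau k - tau b)%R -> b <= k.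
  move/in_tinterval_ge0; rewrite subr_ge0 le_eqVlt => /orP[/eqP/esym/Hb //|].
  by move/tau_lt_pos/ltnW.
have [[k0 Jk0]|none] := pselect (exists k : position rho, in_tinterval J (tau k - tau b)%R);
    last first.
  have ET : TSeg (lab rho) J b = [::].
    rewrite /TSeg (eq_filter (a2 := pred0)) ?filter_pred0 // => k.
    by apply: contra_notF none => Jk; exists k.
  split=> [[[Hr _]|[t1 [_ J1 _]]]|[w []]].
  - by exists [::]; rewrite ET.
  - by case: none; exists t1.
  rewrite ET; case: w => // _ Hr; left; split=> // k _ Jk.
  by case: none; exists k.
split.
  case=> [[_ /(_ k0 (Jb _ Jk0))] //|[t1 [_ J1 [t2 [_ J2 Hall]]]]].
  have Jk (k : position rho) : in_tinterval J (tau k - tau b)%R -> t1 <= k /\ k <= t2.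
    by move=> Jk; have [H _] := Hall k (Jb k Jk) Jk.
  have [_ [p [Hp [a [_ [Ha [Kt1 [t12 [v [Hv Hpv]]]]]]]]]] := Hall k0 (Jb k0 Jk0) Jk0.
  exists (a :: v); rewrite (TSeg_labels J1 J2 Jk t12); split=> //.
  by apply/(re_splitP _ [:: a]); exists p.
have [t1 J1 min1] := @arg_minnP _ k0
  (fun k : position rho => in_tinterval J (tau k - tau b)%R) val Jk0.
have [t2 J2 max2] := @arg_maxnP _ k0
  (fun k : position rho => in_tinterval J (tau k - tau b)%R) val Jk0.
have t12 : t1 <= t2 by apply: min1.
have Jk (k : position rho) : in_tinterval J (tau k - tau b)%R -> t1 <= k /\ k <= t2.
  by move=> Jk; split; [apply: min1 | apply: max2].
case=> w; rewrite (TSeg_labels J1 J2 Jk t12); case: w => [[]//|a v] [[Kt1 Hv]] Hr.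
have [p [Hp Ha Hpv]] := (re_splitP _ [:: a] v).1 Hr.
right; exists t1; split=> //; first exact: Jb.
exists t2; split=> //; first exact: Jb.
move=> k _ Hk; split; first exact: Jk.
exists p; split=> //; exists a; split; first by apply: mem_In; rewrite mem_enum.
by split=> //; split=> //; split=> //; exists v.
Qed.

(** [Rat] depends on its position only through the time stamp, so it may be evaluated at the start
    of the block. *)
Lemma rat_expressible J r : expressible1 (@rat_at J r).
Proof.
move=> n m x xn.
apply: eq_mso_expressible (tc_definable_expressible (@rat_definable J r) m xn).
move=> rho e E _; rewrite /rat_at /TSeg; split=> [[b [_ [_ ->]]] //|H].
by have [b [Hb [bx Eb]]] := block_start_exists (e x); exists b; split=> //; rewrite Eb.
Qed.

End Operators.

(** * Induction on RatMTL formulas and the equivalence *)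

Lemma until_open_matches (R : realType) (Sigma : finType)
    (F : forall rho : timed_word R Sigma, position rho -> Prop) rho (i j : position rho) :
  open_matches (fun _ : 'I_1 => F) (RStar (RSym ord0)) i j <->
  i < j /\ forall k : position rho, i < k < j -> F rho k.
Proof.
(* Over a one-letter alphabet the star accepts every word, so matching only asks for F at all
   intermediate positions: [Until] is a case of [FRat]. *)
have Hstar (w : seq 'I_1) : re_lang (RStar (RSym ord0)) w.
  elim: w => [|a w IH]; first exact: re_star0.
  rewrite -cat1s; apply: re_starS IH.
  by have -> : a = ord0 by [exact: ord1]; exact: re_sym.
rewrite open_matchesP; split=> -[ij H]; split=> // {ij}.
  case: H => w []; rewrite /Seg => Hw _ k Hk.
  have : k \in [seq k : position rho <- enum (position rho) | i < k < j].
    by rewrite mem_filter Hk mem_enum.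
  elim: [seq _ <- _ | _] w Hw => // l s IH [|a w] //= [Fl Hw].
  by rewrite inE => /orP[/eqP-> //|]; apply: IH Hw.
pose s := [seq k : position rho <- enum (position rho) | i < k < j].
exists (nseq (size s) ord0); split=> //; rewrite /Seg -/s.
have : forall k, k \in s -> F rho k by move=> k; rewrite mem_filter => /andP[/H].
elim: s => //= l s IH Hs; split; first by apply: Hs; rewrite inE eqxx.
by apply: IH => k ks; apply: Hs; rewrite inE ks orbT.
Qed.

Lemma ratmtl_expressible (R : realType) (Sigma : finType) (phi : ratmtl Sigma) :
  expressible1 (fun (rho : timed_word R Sigma) i => ratmtl_sat i phi).
Proof.
elim: phi => [a||f IHf g IHg|f IHf|f IHf J g IHg|J N S IH r|J N S IH r f IHf]
  n m x xn; have n0 : 0 < n by lia.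
- by exists 0, (MLetter a x); split=> //=; rewrite xn.
- exact: mso_expressible_const.
- by apply: mso_expressible_and; [apply: IHf | apply: IHg].
- by apply: mso_expressible_not; apply: IHf.
- have H := frat_expressible (fun _ : 'I_1 => IHf) J (RStar (RSym ord0)) IHg m xn.
  apply: eq_mso_expressible H => rho e E _; split=> -[j].
    by case=> Hg Hj /until_open_matches [ij Hf]; exists j.
  by case=> ij Hg Hj Hf; exists j; split=> //; apply/until_open_matches.
- exact: rat_expressible.
- have H := frat_expressible IH J r IHf m xn.
  apply: eq_mso_expressible H => rho e E _; split=> -[j].
    by case=> Hg Hj /open_matchesP [ij Hf]; exists j.
  by case=> ij Hg Hj Hf; exists j; split=> //; apply/open_matchesP.
Qed.

Theorem theorem3 (R : realType) (Sigma : finType) :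
  (forall (k : nat) (psi : tcform Sigma), qk_tc k psi ->
     exists phi : ratmtl Sigma,
       forall rho : timed_word R Sigma, ratmtl_lang phi rho <-> tc_lang psi rho)
  /\
  (forall phi : ratmtl Sigma,
     exists (k : nat) (psi : tcform Sigma), qk_tc k psi /\
       forall rho : timed_word R Sigma, tc_lang psi rho <-> ratmtl_lang phi rho).
Proof.
split=> [k psi /((@qk_translation R Sigma k).2 psi) [phi Hphi]|phi].
  by exists phi => rho; apply: (Hphi (at_pos ord0)).
have [k [psi [Hpsi H]]] := tc_definable_base (@ratmtl_expressible R Sigma phi 1 0 0 isT).
(* The first position of a word starts its block, so the constraint is correct there. *)
by exists k, psi; split=> // rho; apply: H.
Qed.
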